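(* Let $c_1\in\mathrm{Hom}_C(\mathcal{D},C)$ be such that $c_1(\mathfrak{h})\neq 0$ and $\det(A^{c_1})\neq 0$, and suppose that $C(x)\otimes_D\mathcal{R}$ (tensor product formed via $c_1:D\to C(x)$) is not the zero ring. Let $\mathbf{m}$ be a maximal $\sigma$-ideal of $C(x)\otimes_D\mathcal{R}$ and put $\mathcal{S}_{\sigma,c_1}=(C(x)\otimes_D\mathcal{R})/\mathbf{m}$. Then $\mathrm{stab}(\mathbf{m})$ is the $\sigma$-Galois group of $\mathcal{S}_{\sigma,c_1}$ over $C(x)$.
   Context: Conventions: rings are commutative with $1$, fields have characteristic $0$. A $\sigma\delta$-ring is a ring with an automorphism $\sigma$ and a derivation $\delta$ that commute; $\sigma$-rings and $\delta$-rings have only the respective operator. A $\sigma\delta$- (resp. $\sigma$-, $\delta$-) ideal is an ideal stable under the operators; a ring with operators is simple if it is nonzero and its only such ideals are $(0)$ and itself. $S^{\sigma}$, $S^{\delta}$, $S^{\sigma\delta}$ denote constants: elements with $\sigma(s)=s$, with $\delta(s)=0$, with both, respectively. ''Maximal $\sigma$-ideal'' means maximal among proper $\sigma$-ideals. Standing data: $\mathcal{D}$ is an integral domain which is a simple $\delta$-ring, finitely generated over the algebraically closed field $C=\mathcal{D}^\delta$; $k_0$ is its field of fractions (so $k_0^\delta=C$). $k_0(x)$ is the $\sigma\delta$-field with $\sigma|_{k_0}=\mathrm{id}$, $\sigma(x)=x+1$, $\delta(x)=0$. Consider the system $\sigma(Y)=AY,\ \delta(Y)=BY$ with $A\in\mathrm{GL}_n(k_0(x))$,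 $B\in\mathrm{gl}_n(k_0(x))$ and $\sigma(B)A=\delta(A)+AB$. $R$ is a $\sigma\delta$-Picard-Vessiot ring over $k_0(x)$ for it: $R$ is a simple $\sigma\delta$-ring containing $k_0(x)$ and $R=k_0(x)[\mathcal{X},1/\det(\mathcal{X})]$ with $\mathcal{X}\in\mathrm{GL}_n(R)$ satisfying the system; $\mathcal{X}$ is fixed. $\mathfrak{h}\in\mathcal{D}[x]\setminus\{0\}$ is such that all entries of $A,B$ lie in $\mathcal{D}[x,1/\mathfrak{h}]$; $D=\mathcal{D}[x][\{1/\sigma^i(\mathfrak{h}) : i\in\mathbb{Z}\}]$; $\mathcal{R}=D[\mathcal{X},1/\det(\mathcal{X})]$, and $\mathcal{R}$ is a $\sigma\delta$-subring of $R$. Group: for matrices, $(a_{ij})\otimes(b_{ij}):=(\sum_l a_{il}\otimes b_{lj})$. Put $\mathcal{Z}=\mathcal{X}^{-1}\otimes_{k_0(x)}\mathcal{X}$, $C[G]=(R\otimes_{k_0(x)}R)^{\sigma\delta}=C[\mathcal{Z},1/\det(\mathcal{Z})]$, and $G=\mathrm{Hom}_C(C[G],C)$, the affine algebraic group identified with the group $\sigma\delta\text{-}\mathrm{Gal}(R/k_0(x))$ of $\sigma\delta$-automorphisms of $R$ over $k_0(x)$ via $g\mapsto\tau_g$, $\tau_g(\mathcal{X})=\mathcal{X}g(\mathcal{Z})$. Via $g\mapsto g(\mathcal{Z})$, $G$ is an algebraic subgroup of $\mathrm{GL}_n(C)$. Specialization: $c_1\in\mathrm{Hom}_C(\mathcal{D},C)$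 is extended to $C[x]$-linear ring homomorphism on $\mathcal{D}[x]$ and, when $c_1(\mathfrak{h})\neq0$, to the unique $C[x]$-homomorphism $c_1:D\to C(x)$ extending it. $A^{c_1}$ is obtained by applying $c_1$ to the entries. $C(x)$ is a $\sigma$-field with $\sigma(x)=x+1$, $\sigma|_C=\mathrm{id}$, and $T=C(x)\otimes_D\mathcal{R}$ is a $\sigma$-ring if nonzero. For $g\in G$, $\rho_g:T\to T$ is the $C(x)$-algebra automorphism with $\rho_g(1\otimes\mathcal{X})=(1\otimes\mathcal{X})g(\mathcal{Z})$, and $\mathrm{stab}(\mathbf{m})=\{g\in G:\rho_g(\mathbf{m})\subseteq\mathbf{m}\}$. The ring $\mathcal{S}_{\sigma,c_1}$ is a $\sigma$-Picard-Vessiot ring over $C(x)$ for $\sigma(Y)=A^{c_1}Y$ with fundamental matrix $\bar{\mathcal{X}}=1\otimes\mathcal{X}\bmod\mathbf{m}$; its $\sigma$-Galois group is the group of $\sigma$-automorphisms of $\mathcal{S}_{\sigma,c_1}$ over $C(x)$, identified with the algebraic group $\mathrm{Hom}_C((\mathcal{S}_{\sigma,c_1}\otimes_{C(x)}\mathcal{S}_{\sigma,c_1})^\sigma,C)$ and embedded in $\mathrm{GL}_n(C)$ via $\tau\mapsto\bar{\mathcal{X}}^{-1}\tau(\bar{\mathcal{X}})$. *)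

(* Defs.v *)
From HB Require Import structures.
From mathcomp Require Import all_boot all_order all_algebra generic_quotient.
From mathcomp Require Import ring_quotient boolp classical_sets.

Set Implicit Arguments.
Unset Strict Implicit.
Unset Printing Implicit Defensive.

Import GRing.Theory.

Local Open Scope classical_set_scope.
Local Open Scope ring_scope.
Local Open Scope quotient_scope.

Record automorphism (R : nzRingType) := Automorphism {
  aut_morph :> {rmorphism R -> R};
  aut_bij : bijective aut_morph }.

Record derivation (R : nzRingType) := Derivation {
  der_morph :> {additive R -> R};
  derM : forall a b, der_morph (a * b) = der_morph a * b + a * der_morph b }.

Section Ideals.
Variable R : comNzRingType.

Definition is_ideal (I : set R) : Prop :=
  [/\ I 0, forall a b, I a -> I b -> I (a + b) & forall a b, I b -> I (a * b)].

Definition stable (f : R -> R) (I : set R) : Prop := forall a, I a -> I (f a).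

(* The ring is nonzero because it is a [comNzRingType]. *)
Definition simple_ring (ops : set (R -> R)) : Prop :=
  forall I : set R, is_ideal I -> (forall f, ops f -> stable f I) ->
  I = [set 0] \/ I = setT.

(* [idealr R] is the library's type of proper ideals. *)
Definition maximal_sigma_ideal (s : R -> R) (m : idealr R) : Prop :=
  stable s [set` m] /\
  forall J : set R, is_ideal J -> stable s J -> ~ J 1 ->
    [set` m] `<=` J -> J = [set` m].

(* The operator induced by [f] on the quotient by an [f]-stable ideal. *)
Definition quot_op (m : idealr R) (f : R -> R)
    (y : {ideal_quot m}) : {ideal_quot m} :=
  \pi_{ideal_quot m} (f (repr y)).

End Ideals.

Section Subrings.
Variable R : comNzRingType.

Record subring_of (P : subringClosed R) :=
  SubringOf { subring_val : R; _ : subring_val \in P }.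

HB.instance Definition _ P := [isSub of subring_of P for @subring_val P].
HB.instance Definition _ P := [Choice of subring_of P by <:].
HB.instance Definition _ P :=
  [SubChoice_isSubComNzRing of subring_of P by <:].

Definition gen_subring (G : set R) : {pred R} :=
  fun r => r \in smallest [set P : set R | subring_closed (mem P)] G.

Lemma gen_subringP (G : set R) r :
  reflect (forall P : set R, subring_closed (mem P) -> G `<=` P -> P r)
          (r \in gen_subring G).
Proof.
apply: (iffP idP) => [|h].
  by rewrite [_ \in gen_subring _]/(_ \in smallest _ _) inE => h P hP GP; apply: h.
by rewrite [_ \in gen_subring _]/(_ \in smallest _ _) inE => P [hP GP]; apply: h.
Qed.

Lemma gen_subring_closed (G : set R) : subring_closed (gen_subring G).
Proof.
split.
- by apply/gen_subringP => P [h1 _ _] _; have := h1; rewrite inE.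
- move=> a b /gen_subringP ha /gen_subringP hb; apply/gen_subringP => P hP GP.
  case: (hP) => _ hB _; have := hB a b; rewrite !inE.
  by apply; [apply: ha | apply: hb].
- move=> a b /gen_subringP ha /gen_subringP hb; apply/gen_subringP => P hP GP.
  case: (hP) => _ _ hM; have := hM a b; rewrite !inE.
  by apply; [apply: ha | apply: hb].
Qed.

HB.instance Definition _ G :=
  GRing.isSubringClosed.Build R (gen_subring G) (gen_subring_closed G).

Lemma gen_subring_sub (G : set R) r : G r -> r \in gen_subring G.
Proof. by move=> Gr; apply/gen_subringP => P _; apply. Qed.

End Subrings.

(* The ring of constants of a ring with operators [s], [d]. *)
Section Constants.
Variables (R : comNzRingType) (s : automorphism R) (d : derivation R).

Definition sd_const : {pred R} := fun r => (s r == r) && (d r == 0).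

Lemma sd_const_closed : subring_closed sd_const.
Proof.
split.
- rewrite unfold_in /sd_const rmorph1 eqxx /=.
  have := derM d 1 1; rewrite !mulr1 mul1r => /eqP.
  by rewrite -subr_eq0 opprD addrA subrr add0r oppr_eq0.
- move=> a b /andP[/eqP sa /eqP da] /andP[/eqP sb /eqP db].
  by rewrite unfold_in /sd_const rmorphB (raddfB d) sa sb da db subr0 !eqxx.
- move=> a b /andP[/eqP sa /eqP da] /andP[/eqP sb /eqP db].
  by rewrite unfold_in /sd_const rmorphM derM sa sb da db mul0r mulr0 addr0 !eqxx.
Qed.

HB.instance Definition _ :=
  GRing.isSubringClosed.Build R sd_const sd_const_closed.

Definition sd_constants : Type := subring_of sd_const.

HB.instance Definition _ := GRing.SubComNzRing.on sd_constants.

End Constants.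

(* [T], with [j1] and [j2], is the tensor product of the [A]-algebras [B1] and
   [B2], i.e. their coproduct; [j1 b1 * j2 b2] is the tensor b1 (x) b2.  In the
   universal property the test ring may be zero. *)
Definition is_tensor_product (A B1 B2 T : comNzRingType)
    (f1 : {rmorphism A -> B1}) (f2 : {rmorphism A -> B2})
    (j1 : {rmorphism B1 -> T}) (j2 : {rmorphism B2 -> T}) : Prop :=
  (forall a, j1 (f1 a) = j2 (f2 a)) /\
  forall (Q : comPzRingType)
         (u1 : {rmorphism B1 -> Q}) (u2 : {rmorphism B2 -> Q}),
    (forall a, u1 (f1 a) = u2 (f2 a)) ->
    exists u : {rmorphism T -> Q},
      [/\ forall b, u (j1 b) = u1 b, forall b, u (j2 b) = u2 b &
          forall v : {rmorphism T -> Q},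
            (forall b, v (j1 b) = u1 b) -> (forall b, v (j2 b) = u2 b) ->
            forall t, v t = u t].

Definition ratfun (F : idomainType) : fieldType := {fraction {poly F}}.

Definition ratvar (F : idomainType) : ratfun F := tofrac 'X.

Definition ratC (F : idomainType) : {rmorphism F -> ratfun F} :=
  @tofrac _ \o @polyC F.

Section BaseRings.
Variable Dc : idomainType.

Definition polyK : {rmorphism {poly Dc} -> ratfun {fraction Dc}} :=
  @tofrac _ \o map_poly (@tofrac Dc).

Definition cstK : {rmorphism Dc -> ratfun {fraction Dc}} := polyK \o @polyC Dc.

Definition localized_at (h : {poly Dc}) : {pred ratfun {fraction Dc}} :=
  gen_subring (range polyK `|` [set (polyK h)^-1]).

(* All images of [f] under s ^ i for i an integer of either sign. *)
Definition shifts (L : Type) (s : L -> L) (f : L) : set L :=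
  [set g | exists i : nat, g = iter i s f \/ iter i s g = f].

Variables (s : automorphism (ratfun {fraction Dc})) (h : {poly Dc}).

(* D = Dc[x][1 / sigma^i(h), i integer], inside k0(x) *)
Definition in_D : {pred ratfun {fraction Dc}} :=
  gen_subring (range polyK `|` [set g^-1 | g in shifts s (polyK h)]).

HB.instance Definition _ := GRing.SubringClosed.on in_D.

Definition ringD : Type := subring_of in_D.

HB.instance Definition _ := GRing.SubComNzRing.on ringD.

End BaseRings.

(* Generators of B[X, 1/det X]. *)
Definition matrix_gens (R : comUnitRingType) (n : nat) (B : set R)
    (X : 'M[R]_n) : set R :=
  B `|` [set r | exists i j, r = X i j] `|` [set (\det X)^-1].

(* The ring D[X, 1/det X] inside R. *)
Section CalR.
Variables (Dc : idomainType) (s : automorphism (ratfun {fraction Dc})).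
Variables (h : {poly Dc}) (R : comUnitRingType).
Variables (iK : {rmorphism ratfun {fraction Dc} -> R}).
Variables (n : nat) (X : 'M[R]_n).

Definition in_calR : {pred R} :=
  gen_subring (matrix_gens (iK @` [set` in_D s h]) X).

HB.instance Definition _ := GRing.SubringClosed.on in_calR.

Definition calR : Type := subring_of in_calR.

HB.instance Definition _ := GRing.SubComNzRing.on calR.

Lemma D_to_calR_subproof (a : ringD s h) : iK (val a) \in in_calR.
Proof.
apply: gen_subring_sub; left; left; exists (val a) => //.
exact: (valP a).
Qed.

Definition D_to_calR_fun (a : ringD s h) : calR :=
  SubringOf (D_to_calR_subproof a).

Lemma D_to_calR_zmod : zmod_morphism D_to_calR_fun.
Proof. by move=> a b; apply: val_inj; rewrite /= !rmorphB. Qed.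

Lemma D_to_calR_monoid : monoid_morphism D_to_calR_fun.
Proof.
split; first by apply: val_inj; rewrite /= !rmorph1.
by move=> a b; apply: val_inj; rewrite /= !rmorphM.
Qed.

HB.instance Definition _ :=
  GRing.isZmodMorphism.Build (ringD s h) calR D_to_calR_fun D_to_calR_zmod.
HB.instance Definition _ :=
  GRing.isMonoidMorphism.Build (ringD s h) calR D_to_calR_fun D_to_calR_monoid.

Definition D_to_calR : {rmorphism ringD s h -> calR} := D_to_calR_fun.

Lemma X_in_calR i j : X i j \in in_calR.
Proof. by apply: gen_subring_sub; left; right; exists i, j. Qed.

Definition X_calR : 'M[calR]_n := \matrix_(i, j) SubringOf (X_in_calR i j).

End CalR.

(* Entries of [A] outside [D] are sent to [c1 0 = 0]; under the standing
   assumptions there are none. *)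
Definition specialize (Dc : idomainType)
    (s : automorphism (ratfun {fraction Dc})) (h : {poly Dc})
    (F : fieldType) (c1 : {rmorphism ringD s h -> F}) (n : nat)
    (A : 'M[ratfun {fraction Dc}]_n) : 'M[F]_n :=
  map_mx (fun a => c1 (insubd (0 : ringD s h) a)) A.

(* The C-points of C[G], where C[G] is the ring of constants of the tensor
   square [W], made into a C-algebra by [iW]. *)
Section Group.
Variables (C : fieldType) (W : comNzRingType).
Variables (sW : automorphism W) (dW : derivation W).
Variables (iW : {rmorphism C -> W}).

Definition points : set {rmorphism sd_constants sW dW -> C} :=
  [set g | forall (c : C) (z : sd_constants sW dW), val z = iW c -> g z = c].

(* The matrix g(Z).  The entries of [Z] do lie in the ring of constants for
   the [Z] of the theorem, so the default value 0 plays no role. *)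
Definition eval_mx (n : nat) (Z : 'M[W]_n)
    (g : {rmorphism sd_constants sW dW -> C}) : 'M[C]_n :=
  map_mx (fun z => g (insubd (0 : sd_constants sW dW) z)) Z.

End Group.

(* Here [T] is a C(x)-algebra via [j], and [XT] is the matrix 1 (x) X over [T]. *)
Section Specialized.
Variables (C : fieldType) (T : comNzRingType) (j : {rmorphism ratfun C -> T}).
Variables (n : nat) (XT : 'M[T]_n).

(* [rho] is the C(x)-algebra automorphism with rho(1 (x) X) = (1 (x) X) M. *)
Definition is_rho (M : 'M[C]_n) (rho : automorphism T) : Prop :=
  (forall f, rho (j f) = j f) /\
  map_mx rho XT = XT *m map_mx (fun c => j (ratC C c)) M.

Variable m : idealr T.

(* The membership condition defining stab(m), in terms of the matrix M = g(Z). *)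
Definition in_stab (M : 'M[C]_n) : Prop :=
  exists rho : automorphism T, is_rho M rho /\ stable rho [set` m].

Definition Xbar : 'M[{ideal_quot m}]_n := map_mx \pi_{ideal_quot m} XT.

Variable sT : automorphism T.

(* The sigma-automorphisms of T/m over C(x). *)
Definition sigma_Gal : set (automorphism {ideal_quot m}) :=
  [set tau | (forall y, tau (quot_op sT y) = quot_op sT (tau y)) /\
             (forall f, tau (\pi_{ideal_quot m} (j f))
                        = \pi_{ideal_quot m} (j f))].

(* [M] represents Xbar^-1 tau(Xbar), written without inverse since T/m carries
   no [unitRingType] structure: tau(Xbar) = Xbar M. *)
Definition represents (tau : automorphism {ideal_quot m})
    (M : 'M[C]_n) : Prop :=
  map_mx tau Xbar
  = Xbar *m map_mx (fun c => \pi_{ideal_quot m} (j (ratC C c))) M.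

Definition sigma_Gal_mx : set 'M[C]_n :=
  [set M | M \in unitmx /\ exists2 tau, sigma_Gal tau & represents tau M].

End Specialized.

(* Main.v *)
Require Import Defs.
From HB Require Import structures.
From mathcomp Require Import all_boot all_order all_algebra generic_quotient.
From mathcomp Require Import ring_quotient boolp classical_sets.
From mathcomp Require Import ring.

Set Implicit Arguments.
Unset Strict Implicit.
Unset Printing Implicit Defensive.

Import GRing.Theory.

Local Open Scope classical_set_scope.
Local Open Scope ring_scope.

(** The stabilizer of m and the sigma-Galois group of T / m are both groups of
    invertible matrices M over C.

    One inclusion is formal.  If the automorphism rho of T with rho(X) = X M
    maps m into m, the preimage of m under rho is a proper sigma-ideal
    containing m, so it is m, and rho induces an automorphism of T / m
    ([stab_automorphism]).

    Conversely let tau be a sigma-automorphism of S = T / m over C(x).  The matrix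
    M = Xbar^-1 tau(Xbar) is fixed by sigma.  As S is a simple difference ring
    that is finitely generated over C(x) and C is algebraically closed, its
    sigma-constants are the elements of C ([sigma_constants]); the geometric
    input is that a transcendental element of a finitely generated algebra
    cannot have all its translates invertible
    ([algebraic_of_invertible_translates]).  So M has entries in C.

    It remains to lift tau, that is, to see that X |-> X M defines an
    endomorphism t of R over k0(x).  Let Gamma be the subring of R x R generated
    by the diagonal of k0(x) and the pairs of corresponding entries of X and X M
    and of their inverse determinants.  Because M is constant, Gamma is stable
    under sigma and delta.  The r with (0, r) in Gamma form a stable ideal of R,
    so Gamma is the graph of an endomorphism unless it contains (0, 1)
    ([graph_automorphism]).  In the latter case the analogous relation with
    coefficients regular at c1 contains (0, d) for some nonzero d.  The set of
    these d is stable under sigma and delta, and as Dc is delta-simple it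
    contains 1 ([stable_ideal_contains1]).  But the pairs in that relation
    specialize to pairs (s, tau s) of S up to an invertible factor, which would
    give 1 = tau 0 ([specialized_graph01]).

    The endomorphism t yields everything else.  It preserves D[X, 1/det X] and so
    induces rho on T, compatible with tau and therefore preserving m
    ([gal_stab]).  The map r1 (x) r2 |-> r1 t(r2) from the tensor square of R to R
    sends Z to M and constants to constants; constants of R lie in D[X, 1/det X]
    and map to sigma-constants of S, hence to C.  This is the point g of G with
    g(Z) = M ([gal_point]). *)

(** * Chevalley's theorem over a polynomial ring *)

Lemma gen_subring_ind (R : comNzRingType) (G : set R) (P : R -> Prop) :
  P 1 -> (forall a b, P a -> P b -> P (a - b)) ->
  (forall a b, P a -> P b -> P (a * b)) -> (forall a, G a -> P a) ->
  forall r, r \in gen_subring G -> P r.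
Proof.
move=> P1 PB PM PG r /gen_subringP; apply; last exact: PG.
split; first by rewrite inE.
- by move=> a b; rewrite !inE; apply: PB.
- by move=> a b; rewrite !inE; apply: PM.
Qed.

Section Generic.
Variables (L : idomainType) (beta : L).

(** A nonzero f s stays non-nilpotent modulo beta - n for all large n.  Allowing
    every s, rather than only s = 1, is what lets the property pass to algebraic
    extensions, where leading coefficients have to be avoided too. *)
Definition rarely_invertible (B : comNzRingType) (f : {rmorphism B -> L}) :=
  (exists b, f b = beta) /\
  forall s, f s != 0 -> exists n0 : nat, forall n, (n0 <= n)%N -> forall N t,
    f s ^+ N <> (beta - n%:R) * f t.

Section Adjoin.
Variables (B : comNzRingType) (f : {rmorphism B -> L}) (y : L).

(** The subring B[y] of L is handled through this map from {poly B} to L, which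
    spares a presentation of it by relations. *)
Definition adjoin_fun (p : {poly B}) : L := (map_poly f p).[y].

Lemma adjoin_zmod : zmod_morphism adjoin_fun.
Proof. by move=> p q; rewrite /adjoin_fun rmorphB hornerD hornerN. Qed.

Lemma adjoin_monoid : monoid_morphism adjoin_fun.
Proof.
split; first by rewrite /adjoin_fun rmorph1 hornerC.
by move=> p q; rewrite /adjoin_fun rmorphM hornerM.
Qed.

HB.instance Definition _ :=
  GRing.isZmodMorphism.Build {poly B} L adjoin_fun adjoin_zmod.
HB.instance Definition _ :=
  GRing.isMonoidMorphism.Build {poly B} L adjoin_fun adjoin_monoid.

Definition adjoin : {rmorphism {poly B} -> L} := adjoin_fun.

Lemma adjoinC c : adjoin c%:P = f c.
Proof. by rewrite /= /adjoin_fun map_polyC hornerC. Qed.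

Lemma adjoinX : adjoin 'X = y.
Proof. by rewrite /= /adjoin_fun map_polyX hornerX. Qed.

(** A relation s ^ N = (beta - n) t is then an identity of polynomials in y, and
    it can be read on leading coefficients, that is, in B. *)
Lemma rarely_invertible_transcendental :
  (forall p, map_poly f p != 0 -> adjoin p != 0) ->
  rarely_invertible f -> rarely_invertible adjoin.
Proof.
move=> trans [[b fb] Bf]; split; first by exists b%:P; rewrite adjoinC.
move=> s fs0.
have ms0 : map_poly f s != 0.
  by apply: contra fs0 => /eqP ms; rewrite /= /adjoin_fun ms horner0.
have lc : lead_coef (map_poly f s) = f s`_(size (map_poly f s)).-1.
  by rewrite lead_coefE coef_map.
have : f s`_(size (map_poly f s)).-1 != 0 by rewrite -lc lead_coef_eq0.
move=> /Bf[n0 hn0]; exists n0 => n len N t e.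
have : map_poly f (s ^+ N - (b - n%:R)%:P * t) = 0.
  apply/eqP/negPn/negP => /trans/eqP; apply.
  by rewrite rmorphB rmorphXn rmorphM adjoinC rmorphB rmorph_nat fb e subrr.
rewrite rmorphB rmorphXn rmorphM /= => /eqP; rewrite subr_eq0 => /eqP ep.
have := congr1 lead_coef ep; rewrite lead_coef_exp lc lead_coefE => e2.
apply: (hn0 n len N (t`_(size (map_poly f (b - n%:R)%:P * map_poly f t)).-1)).
by rewrite e2 map_polyC coefCM coef_map /= rmorphB rmorph_nat fb.
Qed.

(** The constant term of a relation satisfied by e is a multiple of e; if it
    vanishes, e can be divided out, L being a domain. *)
Lemma algebraic_multiple e : e != 0 -> forall q, map_poly f q != 0 ->
  (map_poly f q).[e] = 0 ->
  exists c q1, f c != 0 /\ f c = e * (map_poly f q1).[e].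
Proof.
move=> e0; elim/poly_ind => [|q c IH]; first by rewrite rmorph0 eqxx.
rewrite rmorphD rmorphM /= map_polyX map_polyC /= hornerD hornerMX hornerC.
have [->|fc0 _ h] := eqVneq (f c) 0.
  rewrite addr0 mulf_eq0 polyX_eq0 orbF addr0 => q0 /eqP.
  by rewrite mulf_eq0 (negPf e0) orbF => /eqP; apply: IH.
exists c, (- q); split => //; rewrite rmorphN hornerN.
by apply/eqP; rewrite -subr_eq0 mulrN opprK addrC mulrC h.
Qed.

(** Multiplying the equation of y by a power of its leading coefficient l turns
    it into a monic equation for l y. *)
Lemma lead_coef_mul_integral p :
  map_poly f p != 0 -> adjoin p = 0 ->
  integralOver f (lead_coef (map_poly f p) * y).
Proof.
set q := map_poly f p => q0 qy; set l := lead_coef q.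
have : (1 < size q)%N.
  rewrite ltnNge; apply/negP => /size1_polyC qC; move: qy q0.
  by rewrite /= /adjoin_fun -/q qC hornerC => ->; rewrite eqxx.
case sq : (size q) => [|[|d]] // _.
pose r : {poly L} := 'X^(d.+1) + \poly_(i < d.+1) (q`_i * l ^+ (d - i)).
apply: (@integral_root_monic _ _ f _ r).
- by rewrite monicE lead_coefDl ?lead_coefXn // size_polyXn ltnS size_poly.
- rewrite rootE /r hornerD hornerXn horner_poly; apply/eqP.
  transitivity (l ^+ d * q.[y]); last by rewrite [_.[_]]qy mulr0.
  rewrite [q.[y]]horner_coef sq [in RHS]big_ord_recr /= mulrDr mulr_sumr.
  rewrite [RHS]addrC; congr (_ + _).
    have -> : q`_d.+1 = l by rewrite /l lead_coefE sq.
    by rewrite exprMn mulrA -exprSr.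
  apply: eq_bigr => i _.
  have -> : l ^+ d = l ^+ (d - i) * l ^+ i by rewrite -exprD subnK // -ltnS.
  by rewrite exprMn; ring.
- apply/integral_poly => i; rewrite coefD coefXn coef_poly.
  apply: integral_add; first exact: integral_nat.
  case: ifP => _; last exact: integral0.
  rewrite coef_map /= /l lead_coefE coef_map -rmorphXn -rmorphM.
  exact: integral_id.
Qed.

Lemma denominators_of_algebraic l : integralOver f (f l * y) ->
  forall t, exists m, integralOver f (f l ^+ m * adjoin t).
Proof.
move=> ly; elim/poly_ind => [|t c [m IH]].
  by exists 0; rewrite rmorph0 mulr0; apply: integral0.
exists m.+1; rewrite rmorphD rmorphM adjoinX adjoinC mulrDr.
apply: integral_add.
  rewrite (_ : _ * _ = (f l ^+ m * adjoin t) * (f l * y)).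
    exact: integral_mul.
  by rewrite exprS; ring.
by rewrite -rmorphXn -rmorphM; apply: integral_id.
Qed.

(** Homogenizing a polynomial of degree r at v with x v in B: all terms but the
    leading one are divisible by x. *)
Lemma clear_integral_equation x v (b w : B) : f b = x -> x * v = f w ->
  forall r (q : {poly B}), (size q <= r.+1)%N ->
  exists t, x ^+ r * (map_poly f q).[v] = f (q`_r * w ^+ r) + x * f t.
Proof.
move=> fb xv; elim=> [|r IH] q sq.
  exists 0; rewrite (size1_polyC sq) map_polyC /= hornerC coefC eqxx.
  by rewrite !rmorphM !rmorphXn !rmorph0 !expr0 mul1r mulr0 mulr1 addr0.
have qE : q = (\poly_(i < r.+1) q`_i.+1) * 'X + (q`_0)%:P.
  apply/polyP => -[|i]; rewrite coefD coefMX coefC coef_poly /= ?add0r //.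
  rewrite addr0; case: ltnP => // le; rewrite nth_default //.
  by apply: leq_trans sq _.
have [t ht] := IH _ (size_poly r.+1 (fun i => q`_i.+1)).
exists (t * w + b ^+ r * q`_0).
rewrite {1}qE rmorphD rmorphM /= map_polyX map_polyC hornerD hornerMX hornerC /=.
transitivity (x ^+ r * (map_poly f (\poly_(i < r.+1) q`_i.+1)).[v] * (x * v)
              + x ^+ r.+1 * f q`_0); first by rewrite exprSr; ring.
rewrite ht xv coef_poly ltnSn rmorphD !rmorphM !rmorphXn fb !exprSr.
by ring.
Qed.

(** After inverting the leading coefficient l of an equation of y, the ring B[y]
    is integral over B, and every nonzero s of B[y] divides some nonzero c of B.  If beta - n divides
    s ^ N, it divides c ^ N, and integrality brings the quotient back to B, so
    beta - n divides a power of c l in B. *)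
Lemma rarely_invertible_algebraic p :
  map_poly f p != 0 -> adjoin p = 0 ->
  rarely_invertible f -> rarely_invertible adjoin.
Proof.
move=> p0 py [[b fb] Bf]; split; first by exists b%:P; rewrite adjoinC.
move=> s fs0.
have := lead_coef_mul_integral p0 py.
set l := p`_(size (map_poly f p)).-1.
have lc : lead_coef (map_poly f p) = f l by rewrite lead_coefE coef_map.
have fl0 : f l != 0 by rewrite -lc lead_coef_eq0.
rewrite lc => /denominators_of_algebraic den.
have [c [s' [fc0 fc]]] : exists c s', f c != 0 /\ f c = adjoin s * adjoin s'.
  have [m [q mq qs]] := den s.
  have e0 : f l ^+ m * adjoin s != 0 by rewrite mulf_neq0 // expf_neq0.
  have mq0 : map_poly f q != 0 by exact/monic_neq0/monic_map.
  have [c [q1 [fc0 fc]]] := algebraic_multiple e0 mq0 (eqP qs).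
  have [q2 hq2] : exists q2,
      (map_poly f q1).[f l ^+ m * adjoin s] = adjoin q2.
    elim/poly_ind: q1 {fc} => [|q1 d [q2 IH]].
      by exists 0; rewrite !rmorph0 horner0.
    exists (q2 * (l%:P ^+ m * s) + d%:P).
    rewrite !rmorphD !rmorphM !rmorphXn !adjoinC /= map_polyX map_polyC.
    by rewrite hornerD hornerMX hornerC IH.
  exists c, (l%:P ^+ m * q2); split=> //; rewrite fc hq2 !rmorphM rmorphXn adjoinC.
  by ring.
have : f (c * l) != 0 by rewrite rmorphM mulf_neq0.
move=> /Bf[n0 hn0]; exists n0 => n len N t e.
have [m [q mq qv]] := den (t * s' ^+ N).
set v := f l ^+ m * _ in qv.
have xv : (beta - n%:R) * v = f (l ^+ m * c ^+ N).
  rewrite /v !rmorphM !rmorphXn fc exprMn e; ring.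
have [t0] := @clear_integral_equation (beta - n%:R) v (b - n%:R) _
  ltac:(by rewrite rmorphB rmorph_nat fb) xv (size q).-1 q
  ltac:(by rewrite -ltnS; case: (size q)).
have -> : q`_(size q).-1 = 1 by move/monicP: mq; rewrite lead_coefE.
rewrite (eqP qv) mulr0 mul1r => /esym/eqP; rewrite addr_eq0 => /eqP h.
set r := (size q).-1 in h.
apply: (hn0 n len (m * r + N * r)%N (- t0 * l ^+ (N * r) * c ^+ (m * r))).
rewrite !rmorphM rmorphN mulrA mulrA mulrN -h.
rewrite !rmorphXn !rmorphM !rmorphXn exprMn !exprD exprMn -!exprM; ring.
Qed.

Lemma rarely_invertible_adjoin :
  rarely_invertible f -> rarely_invertible adjoin.
Proof.
move=> Bf.
have [[p [p0 py]]|h] := pselect (exists p, map_poly f p != 0 /\ adjoin p = 0).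
  exact: rarely_invertible_algebraic p0 py Bf.
apply: rarely_invertible_transcendental Bf => p p0; apply/eqP => py.
by apply: h; exists p.
Qed.

End Adjoin.
End Generic.

(** An ideal maximal among those avoiding a multiplicative set is prime. *)
Lemma exists_prime_avoiding (S : comNzRingType) (M : set S) :
  M 1 -> (forall a b, M a -> M b -> M (a * b)) -> ~ M 0 ->
  exists P : set S, [/\ is_ideal P, forall a, M a -> ~ P a &
    forall a b, P (a * b) -> P a \/ P b].
Proof.
move=> M1 MM M0.
(* The empty set is allowed here, as the union of the empty chain. *)
pose Q (J : set S) := [/\ forall a b, J a -> J b -> J (a + b),
  forall a b, J b -> J (a * b) & forall a, M a -> ~ J a].
have [|P [[PD PZ PM] Pmax]] := @Zorn_bigcup S Q.
  move=> F FQ Ftot; split.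
  - move=> a b [I FI Ia] [J FJ Jb]; have [IJ|JI] := Ftot _ _ FI FJ.
      by exists J => //; have [JD _ _] := FQ _ FJ; apply: JD => //; apply: IJ.
    by exists I => //; have [ID _ _] := FQ _ FI; apply: ID => //; apply: JI.
  - by move=> a b [I FI Ib]; exists I => //; have [_ IZ _] := FQ _ FI; apply: IZ.
  - by move=> a Ma [I FI Ia]; have [_ _ IM] := FQ _ FI; apply: IM Ia.
have maxP J : Q J -> P `<=` J -> J `<=` P.
  by move=> QJ PJ; apply: contrapT => JP; apply: (Pmax J).
have P0 : P 0.
  apply: (maxP (fun a => P a \/ a = 0)); [|by left|by right].
  split.
  - move=> a b [Pa [Pb|->]|-> [Pb|->]]; rewrite ?addr0 ?add0r; try by left.
      by left; apply: PD.
    by right.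
  - by move=> a b [Pb|->]; [left; apply: PZ|right; rewrite mulr0].
  - by move=> a Ma [/(PM _ Ma)//|a0]; apply: M0; rewrite -a0.
exists P; split; [by split|exact: PM|].
move=> a b Pab; apply: contrapT => /not_orP[nPa nPb].
have meets c : ~ P c -> exists p r, P p /\ M (p + r * c).
  move=> nPc; apply: contrapT => nM; apply: nPc.
  apply: (maxP (fun x => exists p r, P p /\ x = p + r * c)); last 2 first.
  - by move=> p Pp; exists p, 0; rewrite mul0r addr0.
  - by exists 0, 1; rewrite mul1r add0r.
  split.
  - move=> x y [p [r [Pp ->]]] [q [s [Pq ->]]]; exists (p + q), (r + s).
    by split; [exact: PD|ring].
  - move=> x y [p [r [Pp ->]]]; exists (x * p), (x * r).
    by split; [apply: PZ|ring].
  - by move=> x Mx [p [r [Pp xE]]]; apply: nM; exists p, r; rewrite -xE.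
have [p [r [Pp Mp]]] := meets a nPa; have [q [s [Pq Mq]]] := meets b nPb.
apply: (PM _ (MM _ _ Mp Mq)).
rewrite (_ : _ * _ = (q + s * b) * p + ((r * a) * q + r * s * (a * b))).
  by apply: (PD); [apply: PZ|apply: PD; apply: PZ].
by ring.
Qed.

Section Inverse.
Variable Q : comNzRingType.

Definition has_inverse : {pred Q} := fun x => `[< exists y, y * x = 1 >].

Definition some_inverse (x : Q) : Q :=
  if pselect (exists y, y * x = 1) is left h then projT1 (cid h) else x.

Lemma some_inverseP : {in has_inverse, left_inverse 1 some_inverse *%R}.
Proof.
move=> x /asboolP hx; rewrite /some_inverse.
by case: pselect => // h; case: (cid h).
Qed.

Lemma has_inverseP x y : y * x = 1 -> has_inverse x.
Proof. by move=> yx; apply/asboolP; exists y. Qed.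

Lemma some_inverse_out : {in [predC has_inverse], some_inverse =1 id}.
Proof.
move=> x /negP hx; rewrite /some_inverse; case: pselect => // h.
by case: hx; apply/asboolP.
Qed.

(** Choosing inverses where they exist gives any ring without zero divisors the
    structure of an idomainType. *)
Lemma idomain_of_integral : (forall x y : Q, x * y = 0 -> x = 0 \/ y = 0) ->
  exists (L : idomainType) (f : {rmorphism Q -> L}), injective f.
Proof.
move=> dom.
pose U := GRing.ComNzRing_hasMulInverse.Build Q
  some_inverseP has_inverseP some_inverse_out.
pose Qu : comUnitRingType := HB.pack Q U.
have ax : GRing.integral_domain_axiom Qu.
  by move=> x y /dom[->|->]; rewrite eqxx ?orbT.
pose I := GRing.ComUnitRing_isIntegral.Build Qu ax.
pose L : idomainType := HB.pack Q U I.
by exists L, (idfun : {rmorphism Q -> L}).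
Qed.

End Inverse.

Section QuotientByIdeal.
Variables (S : comNzRingType) (P : set S).
Hypotheses (idP : is_ideal P) (P1 : ~ P 1).

Definition ideal_pred : {pred S} := fun a => `[< P a >].

Lemma ideal_pred_closed : idealr_closed ideal_pred.
Proof.
case: idP => P0 PD PM; split; [exact/asboolP|by apply/asboolP|].
move=> a u v /asboolP Pu /asboolP Pv; apply/asboolP.
by apply: PD => //; apply: PM.
Qed.

Lemma exists_quotient : exists (Q : comNzRingType) (f : {rmorphism S -> Q}),
  (forall y, exists x, f x = y) /\ forall a, f a = 0 <-> P a.
Proof.
pose H := isIdealr.Build S ideal_pred ideal_pred_closed.
pose I : idealr S := HB.pack ideal_pred H.
pose piI : {rmorphism S -> {ideal_quot I}} := \pi_{ideal_quot I}%qT.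
exists {ideal_quot I}, piI.
split=> [y|a]; first by exists (repr y); rewrite /= reprK.
split.
  move=> /eqP; rewrite -[X in _ == X](rmorph0 piI).
  by rewrite /= -Quotient.idealrBE subr0 => /asboolP.
move=> Pa; apply/eqP; rewrite -[X in _ == X](rmorph0 piI).
by rewrite /= -Quotient.idealrBE subr0; apply/asboolP.
Qed.

End QuotientByIdeal.

Lemma nat_roots_bounded (F : idomainType)
  (charF : forall n, (n%:R == 0 :> F) = (n == 0)%N) (p : {poly F}) :
  p != 0 -> exists n0 : nat, forall n, (n0 <= n)%N -> p.[n%:R] != 0.
Proof.
move=> p0; apply: contrapT => /forallNP h.
have {}h m : exists2 n, (m <= n)%N & p.[n%:R] = 0.
  have /existsNP[n /not_implyP[le /negP/negPn/eqP pn]] := h m.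
  by exists n.
have inj : injective (fun n : nat => n%:R : F).
  move=> a b /eqP; wlog le : a b / (a <= b)%N => [w|].
    by case: (leqP a b) => [/w//|/ltnW/w w' ?]; apply/esym/w'; rewrite eq_sym.
  rewrite eq_sym -subr_eq0 -natrB // charF subn_eq0 => le2.
  by apply/eqP; rewrite eqn_leq le.
have [s us [rs ss]] : exists2 s : seq nat, uniq s &
    all (fun n => p.[n%:R] == 0) s /\ size s = size p.
  elim: (size p) => [|m [s us [rs <-]]]; first by exists [::].
  have [n len pn] := h (\max_(a <- s) a).+1.
  exists (n :: s); last by rewrite /= pn eqxx rs.
  rewrite /= us andbT; apply/negP => ns.
  by have := @leq_bigmax_seq _ s xpredT id n ns isT; rewrite leqNgt len.
have := @max_poly_roots _ p [seq n%:R | n <- s] p0.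
rewrite size_map ss ltnn (map_inj_uniq inj) us => /(_ _ isT).
suff -> : all (root p) [seq n%:R | n <- s] by move=> /(_ isT).
by rewrite all_map; apply: sub_all rs => n; rewrite /= rootE.
Qed.

Lemma rarely_invertible_tower (L : idomainType) (beta : L) (ys : seq L)
    (B : comNzRingType) (f : {rmorphism B -> L}) :
  rarely_invertible beta f ->
  exists (B' : comNzRingType) (f' : {rmorphism B' -> L}),
    [/\ rarely_invertible beta f', range f `<=` range f' &
        [set` ys] `<=` range f'].
Proof.
elim: ys B f => [|y ys IH] B f Bf.
  by exists B, f; split => // x; rewrite /= in_nil.
have [B' [f' [Bf' ff' ysf']]] := IH _ _ (rarely_invertible_adjoin y Bf).
exists B', f'; split=> //.
- apply: subset_trans ff' => _ [a _ <-].
  by exists a%:P => //; rewrite adjoinC.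
- move=> x; rewrite /= in_cons => /orP[/eqP->|/ysf'//].
  by apply: ff'; exists 'X => //; rewrite adjoinX.
Qed.

Lemma rarely_invertible_poly (k : fieldType) (L : idomainType) (beta : L)
    (i : {rmorphism k -> L}) (char0 : forall n, (n%:R == 0 :> k) = (n == 0)%N) :
  (forall p, p != 0 -> (map_poly i p).[beta] != 0) ->
  rarely_invertible beta (adjoin i beta).
Proof.
move=> trans; split; first by exists 'X; rewrite adjoinX.
move=> s s0; have s_neq0 : s != 0 by apply: contraNneq s0 => ->; rewrite rmorph0.
have [n0 hn0] := nat_roots_bounded char0 s_neq0.
exists n0 => n /hn0 sn N t e.
have : s ^+ N = ('X - n%:R) * t.
  apply/eqP; rewrite -subr_eq0; apply/negPn/negP => /trans/eqP; apply.
  rewrite -[LHS]/(adjoin i beta (s ^+ N - ('X - n%:R) * t)).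
  by rewrite rmorphB rmorphXn rmorphM [_ ('X - _)]rmorphB rmorph_nat adjoinX e subrr.
move=> /(congr1 (horner^~ n%:R)).
rewrite horner_exp hornerM hornerD hornerX hornerN -polyC_natr hornerC subrr mul0r.
by move=> /eqP; rewrite expf_eq0 (negPf sn) andbF.
Qed.

(** A transcendental element of a finitely generated algebra takes almost every
    value, so it has a translate by a natural number that is not invertible.
    To argue in a domain, one divides by a prime ideal that meets k[b] trivially;
    the domain is then reached from k[b] by adjoining the generators one by one. *)
Lemma algebraic_of_invertible_translates (k : fieldType)
    (char0 : forall n, (n%:R == 0 :> k) = (n == 0)%N)
    (S : comNzRingType) (i : {rmorphism k -> S}) (gens : seq S)
    (Sgen : forall s, s \in gen_subring (range i `|` [set` gens])) (b : S) :
  (forall n, exists c, c * (b - n%:R) = 1) ->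
  exists2 F : {poly k}, F != 0 & (map_poly i F).[b] = 0.
Proof.
move=> binv; apply: contrapT => nalg.
have [L [f ftrans]] : exists (L : idomainType) (f : {rmorphism S -> L}),
    forall F : {poly k}, F != 0 -> f (map_poly i F).[b] != 0.
  have [|||P [idP PM Pprime]] := @exists_prime_avoiding S
    [set (map_poly i F).[b] | F in [set F | F != 0]].
  - by exists 1; rewrite /= ?oner_neq0 // rmorph1 hornerC.
  - move=> _ _ [F F0 <-] [G G0 <-]; exists (F * G); rewrite /= ?mulf_neq0 //.
    by rewrite rmorphM hornerM.
  - by move=> [F F0 Fb]; apply: nalg; exists F.
  have P1 : ~ P 1.
    by apply: PM; exists 1; rewrite /= ?oner_neq0 // rmorph1 hornerC.
  have [Q [f [fsurj fP]]] := exists_quotient idP P1.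
  have [|L [g ginj]] := @idomain_of_integral Q.
    move=> x y; have [x' <-] := fsurj x; have [y' <-] := fsurj y.
    by rewrite -rmorphM => /fP/Pprime[]/fP; [left|right].
  exists L, (g \o f) => F F0; apply/eqP => /=; rewrite -(rmorph0 g) => /ginj/fP.
  by apply: PM; exists F.
have trans p : p != 0 -> (map_poly (f \o i) p).[f b] != 0.
  by move=> /ftrans; rewrite -horner_map -map_poly_comp.
have [B [h [[_ Bh] kB gB]]] :=
  rarely_invertible_tower [seq f y | y <- gens] (rarely_invertible_poly char0 trans).
have hall s : range h (f s).
  move: s (Sgen s); apply: gen_subring_ind.
  - by exists 1; rewrite // !rmorph1.
  - by move=> x y [x' _ hx] [y' _ hy]; exists (x' - y'); rewrite // !rmorphB hx hy.
  - by move=> x y [x' _ hx] [y' _ hy]; exists (x' * y'); rewrite // !rmorphM hx hy.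
  - move=> x [[c _ <-]|xg]; last by apply: gB; rewrite /= map_f.
    by apply: kB; exists c%:P => //; rewrite adjoinC.
have [|n0 hn0] := Bh 1; first by rewrite rmorph1 oner_neq0.
have [c hc] := binv n0; have [t _ ht] := hall c.
apply: (hn0 n0 (leqnn _) 0 t).
by rewrite ht expr0 -(rmorph_nat f) -rmorphB -rmorphM mulrC hc rmorph1.
Qed.

(** * Constants of finitely generated simple difference rings *)

Lemma fraction_numden (F : idomainType) (f : {fraction F}) :
  exists n d, d != 0 /\ f * tofrac d = tofrac n.
Proof.
elim/quotW: f => x; exists \n_x, \d_x; split; first exact: denom_ratioP.
have -> : tofrac \d_x = \pi_{fraction F}%qT (Ratio \d_x 1) :> {fraction F}.
  by unlock FracField.tofrac.
have -> : tofrac \n_x = \pi_{fraction F}%qT (Ratio \n_x 1) :> {fraction F}.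
  by unlock FracField.tofrac.
rewrite -[LHS]FracField.pi_mul; apply/eqmodP/eqP.
rewrite /FracField.mulf /= !numden_Ratio ?(oner_neq0, mulf_neq0, mulr1) ?denom_ratioP //.
by rewrite mulrC.
Qed.

Lemma tofrac_inj (F : idomainType) : injective (@tofrac F).
Proof. by move=> a b /eqP; rewrite tofrac_eq => /eqP. Qed.

Section Shift.
Variables (F : idomainType) (s : {rmorphism ratfun F -> ratfun F}).
Hypotheses (s_cst : forall a, s (ratC _ a) = ratC _ a).
Hypothesis s_x : s (ratvar _) = ratvar _ + 1.

Lemma tofrac_shift p : s (tofrac p) = tofrac (p \Po ('X + 1)).
Proof.
elim/poly_ind: p => [|p c IH]; first by rewrite comp_poly0 !rmorph0.
rewrite comp_polyD comp_polyM comp_polyX comp_polyC !rmorphD !rmorphM /= IH.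
by rewrite [s (tofrac 'X)]s_x [s (tofrac c%:P)]s_cst rmorphD rmorph1.
Qed.

Hypothesis charF : forall n, (n%:R == 0 :> F) = (n == 0)%N.

Lemma horner_shift (p : {poly F}) n : (p \Po ('X + 1)).[n%:R] = p.[n.+1%:R].
Proof. by rewrite horner_comp hornerD hornerX hornerC -[1]/(1%:R) -natrD addn1. Qed.

(** Evaluating at n, n + 1, ... shows that p and c q agree at infinitely many
    points, where c is the value of p / q at a large n. *)
Lemma shift_invariant_quotient (p q : {poly F}) : q != 0 ->
  (p \Po ('X + 1)) * q = p * (q \Po ('X + 1)) ->
  exists a b, b != 0 /\ b%:P * p = a%:P * q.
Proof.
move=> q0 pq; have [n0 hn0] := nat_roots_bounded charF q0.
exists p.[n0%:R], q.[n0%:R]; split; first exact: hn0.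
apply/eqP; rewrite -subr_eq0; apply/negPn/negP => h0.
have [n1 hn1] := nat_roots_bounded charF h0.
have := hn1 _ (leq_addl n0 n1) => /negP; apply.
rewrite hornerD hornerN !hornerM !hornerC subr_eq0; apply/eqP.
elim: n1 {hn1} => [|m IH]; first by rewrite addn0 mulrC.
have := congr1 (horner^~ (n0 + m)%:R) pq.
rewrite !hornerM !horner_shift addnS => e.
apply: (mulIf (hn0 (n0 + m)%N (leq_addr _ _))).
by rewrite -mulrA e mulrA IH -mulrA [q.[_] * _]mulrC mulrA.
Qed.

Lemma shift_invariant_poly (p : {poly F}) : p \Po ('X + 1) = p ->
  exists a, p = a%:P.
Proof.
move=> pp; have [|a [b [b0 e]]] := @shift_invariant_quotient p 1 (oner_neq0 _).
  by rewrite mulr1 pp -[X in X \Po _]/(1%:P) comp_polyC mulr1.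
exists p`_0; apply: size1_polyC; rewrite -(size_Cmul _ b0) e mulr1.
exact: size_polyC_leq1.
Qed.

End Shift.

Lemma ratfun_shift_constant (C : fieldType)
    (char0 : forall n, (n%:R == 0 :> C) = (n == 0)%N)
    (s : {rmorphism ratfun C -> ratfun C})
    (s_cst : forall a, s (ratC _ a) = ratC _ a)
    (s_x : s (ratvar _) = ratvar _ + 1) (f : ratfun C) :
  s f = f -> exists c, f = ratC _ c.
Proof.
move=> sf; have [p [q [q0 fq]]] := fraction_numden f.
have [|a [b [b0 e]]] := @shift_invariant_quotient C char0 p q q0.
  apply: tofrac_inj; rewrite !tofracM -!(tofrac_shift s_cst s_x) -fq rmorphM /= sf.
  by rewrite -!mulrA [tofrac q * _]mulrC.
exists (a / b); apply: (@mulIf _ (tofrac q)); first by rewrite tofrac_eq0.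
rewrite fq /= -tofracM; congr tofrac.
apply: (mulfI (x := b%:P)); first by rewrite polyC_eq0.
by rewrite e mulrA -polyCM mulrCA mulfV // mulr1.
Qed.

Section SimpleDifferenceRing.
Variables (C : closedFieldType) (char0 : forall n, (n%:R == 0 :> C) = (n == 0)%N).
Variables (sC : {rmorphism ratfun C -> ratfun C}).
Hypotheses (sC_cst : forall c, sC (ratC _ c) = ratC _ c).
Hypothesis (sC_x : sC (ratvar _) = ratvar _ + 1).
Variables (S : comNzRingType) (phi : {rmorphism S -> S}).
Variables (i : {rmorphism ratfun C -> S}).
Hypothesis phi_i : forall f, phi (i f) = i (sC f).
Hypothesis simple : forall J : set S, is_ideal J -> stable phi J -> ~ J 1 ->
  forall a, J a -> a = 0.

(** The ideal generated by a constant is stable. *)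
Lemma sigma_constant_inverse b : phi b = b -> b != 0 -> exists c, c * b = 1.
Proof.
move=> bc /eqP b0; apply: contrapT => ninv; apply: b0.
apply: (simple (J := fun a => exists c, a = c * b)).
- split; first by exists 0; rewrite mul0r.
  + by move=> _ _ [c ->] [d ->]; exists (c + d); rewrite mulrDl.
  + by move=> a _ [c ->]; exists (a * c); rewrite mulrA.
- by move=> _ [c ->]; exists (phi c); rewrite rmorphM bc.
- by move=> [c c1]; apply: ninv; exists c.
- by exists 1; rewrite mul1r.
Qed.

Variable gens : seq S.
Hypothesis Sgen : forall s, s \in gen_subring (range i `|` [set` gens]).

Lemma ratfun_char0 n : (n%:R == 0 :> ratfun C) = (n == 0)%N.
Proof. by rewrite -(rmorph_nat (ratC C)) /= tofrac_eq0 polyC_eq0 char0. Qed.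

(** If b is not in C, all its translates by C are invertible, hence b is
    algebraic over C(x).  Its minimal polynomial is fixed by sigma, because the
    difference with its image has lower degree and still vanishes at b; its
    coefficients thus lie in C and it splits, which makes a product of invertible
    elements vanish. *)
Lemma sigma_constants b : phi b = b -> exists c, b = i (ratC _ c).
Proof.
move=> phib; apply: contrapT => bNC.
have binv c : exists d, d * (b - i (ratC _ c)) = 1.
  apply: sigma_constant_inverse; first by rewrite rmorphB phib phi_i sC_cst.
  by rewrite subr_eq0; apply/eqP => e; apply: bNC; exists c.
have [|F0 F0_neq0 F0b] := algebraic_of_invertible_translates ratfun_char0 Sgen (b := b).
  by move=> n; have [d hd] := binv n%:R; exists d; move: hd; rewrite !rmorph_nat.
pose vanishing n := `[< exists F,
  [/\ F \is monic, (map_poly i F).[b] = 0 & size F = n] >].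
have ex_v F : F != 0 -> (map_poly i F).[b] = 0 -> vanishing (size F).
  move=> F_neq0 Fb; apply/asboolP; exists ((lead_coef F)^-1 *: F); split.
  - by rewrite monicE lead_coefZ mulVf // lead_coef_eq0.
  - by rewrite map_polyZ hornerZ Fb mulr0.
  - by rewrite size_scale // invr_eq0 lead_coef_eq0.
have [m /asboolP[F [Fm Fb <-]] Fmin] :=
  ex_minnP (ex_intro vanishing _ (ex_v _ F0_neq0 F0b)).
have sF : map_poly sC F = F.
  apply/eqP; rewrite -subr_eq0; apply/negPn/negP => G0.
  have /ex_v/Fmin : (map_poly i (map_poly sC F - F)).[b] = 0.
    rewrite rmorphB /= hornerD hornerN Fb subr0 -map_poly_comp.
    rewrite -(@eq_map_poly _ _ (phi \o i)); last by move=> f; rewrite /= phi_i.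
    by rewrite map_poly_comp -phib horner_map Fb rmorph0.
  move=> /(_ G0); rewrite leqNgt => /negP; apply.
  have F_neq0 := monic_neq0 Fm.
  rewrite -(prednK (n := size F)) ?size_poly_gt0 // ltnS.
  apply/leq_sizeP => j; rewrite leq_eqVlt => /orP[/eqP<-|].
    rewrite coefB coef_map.
    have -> : F`_(size F).-1 = 1 by rewrite -lead_coefE (monicP Fm).
    by apply/eqP; rewrite subr_eq0; apply/eqP; exact: rmorph1.
  rewrite prednK ?size_poly_gt0 // => lt.
  by rewrite coefB !nth_default ?subrr ?size_map_poly.
have coefC j : exists c, F`_j = ratC C c.
  by apply: (ratfun_shift_constant char0 sC_cst sC_x); rewrite -[in RHS]sF coef_map.
pose H : {poly C} := \poly_(j < size F) projT1 (cid (coefC j)).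
have FH : F = map_poly (ratC C) H.
  apply/polyP => j; rewrite coef_map coef_poly; case: ltnP => [_|le].
    exact: (projT2 (cid (coefC j))).
  by rewrite nth_default // rmorph0.
have [rs Hrs] := closed_field_poly_normal H.
have Hm : lead_coef H = 1.
  by apply/eqP; rewrite -(fmorph_eq1 (ratC C)) -lead_coef_map -FH -monicE.
rewrite Hm scale1r in Hrs.
have : exists d, d * (map_poly i F).[b] = 1.
  rewrite FH Hrs -map_poly_comp; elim: rs {Hrs} => [|z rs [d IH]].
    by exists 1; rewrite big_nil rmorph1 hornerC mulr1.
  have [e he] := binv z; exists (d * e); rewrite big_cons rmorphM hornerM.
  rewrite rmorphB /= map_polyX map_polyC hornerD hornerX hornerN hornerC /=.
  by rewrite [_ * (map_poly _ _).[b]]mulrC mulrACA he mulr1 IH.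
by move=> [d]; rewrite Fb mulr0 => /eqP; rewrite eq_sym oner_eq0.
Qed.

End SimpleDifferenceRing.

(** * Ring morphisms from their graphs, and tensor products *)

(** The form in which most morphisms below are produced: a subring of a product
    that projects onto the first factor and is single-valued at 0. *)
Lemma graph_rmorph (A B : nzRingType) (G : A -> B -> Prop) :
  G 1 1 -> (forall a b a' b', G a b -> G a' b' -> G (a - a') (b - b')) ->
  (forall a b a' b', G a b -> G a' b' -> G (a * a') (b * b')) ->
  (forall a, exists b, G a b) -> (forall b, G 0 b -> b = 0) ->
  exists f : {rmorphism A -> B}, forall a, G a (f a).
Proof.
move=> G1 GB GM Gtot G0; pose f a := projT1 (cid (Gtot a)).
have Gf a : G a (f a) by rewrite /f; case: cid.
have uniq a b : G a b -> f a = b.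
  move=> Gab; apply/eqP; rewrite -subr_eq0; apply/eqP/G0.
  by rewrite -(subrr a); apply: GB.
have fB : zmod_morphism f by move=> a b; apply/uniq/GB.
have fM : monoid_morphism f by split=> [|a b]; [exact: uniq|apply/uniq/GM].
pose F1 := GRing.isZmodMorphism.Build A B f fB.
pose F2 := GRing.isMonoidMorphism.Build A B f fM.
by exists (HB.pack_for {rmorphism A -> B} f F1 F2).
Qed.

Section SubringVal.
Variables (R : comNzRingType) (P : subringClosed R).
Implicit Types a b : subring_of P.

Lemma val0 : val (0 : subring_of P) = 0. Proof. exact: rmorph0. Qed.
Lemma val1 : val (1 : subring_of P) = 1. Proof. exact: rmorph1. Qed.
Lemma valB a b : val (a - b) = val a - val b. Proof. exact: rmorphB. Qed.
Lemma valM a b : val (a * b) = val a * val b. Proof. exact: rmorphM. Qed.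

End SubringVal.

Lemma codomain_rmorph (A R : comNzRingType) (P : subringClosed R)
    (f : {rmorphism A -> R}) : (forall a, f a \in P) ->
  exists g : {rmorphism A -> subring_of P}, forall a, val (g a) = f a.
Proof.
move=> fP.
have [|a b a' b' e e'|a b a' b' e e'|a|b|g hg] :=
    @graph_rmorph A (subring_of P) (fun a b => val b = f a).
- by rewrite !rmorph1.
- by rewrite !rmorphB /= e e'.
- by rewrite !rmorphM /= e e'.
- by exists (SubringOf (fP a)).
- by rewrite rmorph0 => b0; apply: val_inj; rewrite b0 rmorph0.
- by exists g.
Qed.

(** By the universal property, the inclusion of the subring generated by both
    factors has a section. *)
Lemma tensor_generated (A B1 B2 T : comNzRingType)
    (f1 : {rmorphism A -> B1}) (f2 : {rmorphism A -> B2})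
    (j1 : {rmorphism B1 -> T}) (j2 : {rmorphism B2 -> T}) :
  is_tensor_product f1 f2 j1 j2 ->
  forall t, t \in gen_subring (range j1 `|` range j2).
Proof.
move=> [comm univ] t; set G := range j1 `|` range j2.
have [u1 hu1] : exists u : {rmorphism B1 -> subring_of (gen_subring G)},
    forall b, val (u b) = j1 b.
  by apply: codomain_rmorph => b; apply: gen_subring_sub; left; exists b.
have [u2 hu2] : exists u : {rmorphism B2 -> subring_of (gen_subring G)},
    forall b, val (u b) = j2 b.
  by apply: codomain_rmorph => b; apply: gen_subring_sub; right; exists b.
have [|u [uj1 uj2 _]] := univ _ u1 u2.
  by move=> a; apply: val_inj; rewrite hu1 hu2.
have [v [_ _ vuniq]] := univ T j1 j2 comm.
have -> : t = val (u t); last exact: valP.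
rewrite -[RHS]/((val \o u) t) (vuniq (val \o u)).
- by rewrite -(vuniq idfun).
- by move=> b /=; rewrite uj1 hu1.
- by move=> b /=; rewrite uj2 hu2.
Qed.

Lemma det_in_subring (R : comNzRingType) (P : subringClosed R) n (Y : 'M[R]_n) :
  (forall i j, Y i j \in P) -> \det Y \in P.
Proof.
move=> YP; pose Y' : 'M[subring_of P]_n := \matrix_(i, j) SubringOf (YP i j).
have -> : Y = map_mx val Y' by apply/matrixP => i j; rewrite !mxE.
by rewrite det_map_mx; apply: valP.
Qed.

Lemma derivation1 (R : nzRingType) (d : derivation R) : d 1 = 0.
Proof.
have := derM d 1 1; rewrite !mulr1 mul1r => /eqP.
by rewrite -subr_eq0 opprD addrA subrr add0r oppr_eq0 => /eqP.
Qed.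

Lemma derivationV (R : comUnitRingType) (d : derivation R) (r : R) :
  r \is a GRing.unit -> d r^-1 = - (r^-1 * r^-1 * d r).
Proof.
move=> ur; apply: (mulrI ur); apply/eqP; rewrite mulrN -subr_eq0 opprK !mulrA.
by rewrite divrr // mul1r [r^-1 * _]mulrC addrC -derM divrr // derivation1.
Qed.

(** * Simplicity of Dc[x] as a ring with shift and derivation *)

Section Fractions.
Variable Dc : idomainType.
Local Notation K := (ratfun {fraction Dc}).

Lemma poly_fraction_denominator (P : {poly {fraction Dc}}) :
  exists d q, d != 0 /\ (tofrac d)%:P * P = map_poly (@tofrac Dc) q.
Proof.
elim/poly_ind: P => [|P c [d [q [d0 dP]]]].
  by exists 1, 0; rewrite oner_neq0 mulr0 rmorph0.
have [a [b [b0 cb]]] := fraction_numden c.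
exists (d * b), (b%:P * q * 'X + (d * a)%:P); rewrite mulf_neq0 //; split=> //.
rewrite rmorphD !rmorphM /= map_polyX !map_polyC /= -dP -cb rmorphM /=.
move: (tofrac d)%:P (tofrac b)%:P c%:P => D B E.
by rewrite mulrDr !mulrA [B * D]mulrC; congr (_ + _); rewrite -!mulrA [B * E]mulrC.
Qed.

Lemma K_denominator (f : K) :
  exists p q : {poly Dc}, p != 0 /\ polyK Dc p * f = polyK Dc q.
Proof.
have [P [Q [Q0 fQ]]] := fraction_numden f.
have [a [p [a0 aQ]]] := poly_fraction_denominator Q.
have [b [q [b0 bP]]] := poly_fraction_denominator P.
exists (b%:P * p), (a%:P * q); split.
  rewrite mulf_neq0 ?polyC_eq0 //.
  apply/eqP => p0; move/eqP: aQ; rewrite p0 rmorph0.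
  by rewrite mulf_eq0 polyC_eq0 tofrac_eq0 (negPf a0) (negPf Q0).
rewrite !rmorphM /= !map_polyC /= -aQ -bP !tofracM -fQ.
move: (tofrac _) (tofrac _) (tofrac Q) => A' B' Q'.
by rewrite -!mulrA [Q' * f]mulrC [LHS]mulrCA.
Qed.

Lemma polyK_inj : injective (polyK Dc).
Proof.
move=> p q /tofrac_inj /= e; apply/polyP => i; apply: (@tofrac_inj Dc).
by rewrite -!(coef_map (@tofrac Dc)) e.
Qed.

Lemma polyK_eq0 p : (polyK Dc p == 0) = (p == 0).
Proof. by rewrite -(inj_eq polyK_inj) rmorph0. Qed.

Lemma polyKX : polyK Dc 'X = ratvar _.
Proof. by rewrite /= map_polyX. Qed.

Lemma ratC_tofrac (a : Dc) : polyK Dc a%:P = ratC _ (tofrac a).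
Proof. by rewrite /= map_polyC. Qed.

Section Operators.
Variables (dDc : derivation Dc).
Variables (sK : automorphism K) (dK : derivation K).
Hypotheses (sK_cst : forall a, sK (ratC _ a) = ratC _ a).
Hypothesis (sK_x : sK (ratvar _) = ratvar _ + 1).
Hypothesis (dK_cst : forall a : Dc, dK (cstK Dc a) = cstK Dc (dDc a)).
Hypothesis (dK_x : dK (ratvar _) = 0).

Lemma sK_polyK p : sK (polyK Dc p) = polyK Dc (p \Po ('X + 1)).
Proof.
rewrite [LHS](tofrac_shift sK_cst sK_x) /= map_comp_poly.
by rewrite rmorphD rmorph1 /= map_polyX.
Qed.

Lemma map_poly_derivation p c :
  map_poly dDc (p * 'X + c%:P) = map_poly dDc p * 'X + (dDc c)%:P.
Proof.
apply/polyP => i; rewrite !coefD !coefC !coefMX !coef_map_id0 ?raddf0 //.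
rewrite coefD coefMX coefC.
by case: i => [|i] /=; rewrite ?add0r ?addr0.
Qed.

Lemma dK_polyK p : dK (polyK Dc p) = polyK Dc (map_poly dDc p).
Proof.
elim/poly_ind: p => [|p c IH]; first by rewrite map_poly0 rmorph0 raddf0.
rewrite map_poly_derivation !rmorphD !rmorphM raddfD derM IH polyKX dK_x mulr0 addr0.
by rewrite -[polyK Dc c%:P]/(cstK Dc c) dK_cst.
Qed.

Hypothesis Dc_simple : simple_ring [set dDc : Dc -> Dc].
Hypothesis charD : forall n, (n%:R == 0 :> Dc) = (n == 0)%N.

(** Among the nonzero polynomials of I take one of minimal degree.  The leading
    coefficients in that degree form an ideal of Dc stable under the derivation,
    so it can be chosen monic; its difference with its shift then has lower
    degree, hence vanishes, and a shift-invariant polynomial is constant in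
    characteristic 0. *)
Lemma stable_ideal_contains1 (I : set K) :
  (forall f g, I f -> I g -> I (f + g)) ->
  (forall p f, I f -> I (polyK Dc p * f)) ->
  stable sK I -> stable dK I ->
  (exists2 p, p != 0 & I (polyK Dc p)) -> I 1.
Proof.
move=> ID IM Is Id [p0 p0_neq0 Ip0].
have [m /asboolP[p [p_neq0 Ip <-]] pmin] :
    exists2 m, `[< exists p, [/\ p != 0, I (polyK Dc p) & size p = m] >] &
      forall q, q != 0 -> I (polyK Dc q) -> (m <= size q)%N.
  have [m hm hmin] := ex_minnP (ex_intro
    (fun m => `[< exists p, [/\ p != 0, I (polyK Dc p) & size p = m] >]) (size p0)
    (asboolT (ex_intro _ p0 (And3 p0_neq0 Ip0 erefl)))).
  by exists m => // q q0 Iq; apply/hmin/asboolP; exists q.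
pose top := [set a | exists q, [/\ I (polyK Dc q), (size q <= size p)%N &
  q`_(size p).-1 = a]].
have Iadd q r : I (polyK Dc q) -> I (polyK Dc r) -> I (polyK Dc (q + r)).
  by rewrite rmorphD; apply: ID.
have Imul q r : I (polyK Dc r) -> I (polyK Dc (q * r)) by rewrite rmorphM; apply: IM.
have [|_ ->|top0|topT] := Dc_simple (I := top).
- split.
  + by exists 0; rewrite size_poly0 coef0 -(mul0r p); split=> //; apply: Imul.
  + move=> a b [q [Iq sq <-]] [r [Ir sr <-]]; exists (q + r); rewrite coefD.
    by split=> //; [apply: Iadd|apply: leq_trans (size_polyD _ _) _; rewrite geq_max sq].
  + move=> a b [q [Iq sq <-]]; exists (a%:P * q); rewrite coefCM; split=> //.
      exact: Imul.
    by rewrite mul_polyC; apply: leq_trans (size_scale_leq _ _) sq.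
- move=> a [q [Iq sq <-]]; exists (map_poly dDc q); split.
  + by rewrite -dK_polyK; apply: Id.
  + by apply: leq_trans (size_poly _ _) sq.
  + by rewrite coef_map_id0 ?raddf0.
- have : top (lead_coef p) by exists p; rewrite lead_coefE.
  by rewrite top0 /= => /eqP; rewrite lead_coef_eq0 (negPf p_neq0).
- have [q [Iq sq q1]] : top 1 by rewrite topT.
  have q0 : q != 0.
    by apply/eqP => q0; move/eqP: q1; rewrite q0 coef0 eq_sym oner_eq0.
  have sqE : size q = size p by apply/eqP; rewrite eqn_leq sq pmin.
  have sX1 : size ('X + 1 : {poly Dc}) = 2.
    by rewrite -[1]opprK -polyCN size_XsubC.
  have : q \Po ('X + 1) = q.
    apply/eqP; rewrite -subr_eq0; apply/negPn/negP => r0.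
    have /(pmin _ r0) : I (polyK Dc (q \Po ('X + 1) - q)).
      by rewrite -mulN1r; apply: Iadd; [rewrite -sK_polyK; apply: Is|apply: Imul].
    rewrite leqNgt => /negP; apply.
    rewrite -(prednK (n := size p)) ?size_poly_gt0 // ltnS.
    apply/leq_sizeP => j; rewrite leq_eqVlt => /orP[/eqP<-|].
      have lc : lead_coef (q \Po ('X + 1)) = 1.
        rewrite lead_coef_comp ?sX1 // lead_coefE sqE q1 mul1r.
        have -> : 'X + 1 = 'X - (-1)%:P :> {poly Dc} by rewrite polyCN opprK.
        by rewrite lead_coefXsubC expr1n.
      rewrite coefB q1 -lc lead_coefE size_comp_poly2 // sqE.
      exact: subrr.
    rewrite prednK ?size_poly_gt0 // => lt; rewrite nth_default //.
    apply: leq_trans (size_polyD _ _) _; rewrite size_polyN geq_max.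
    by rewrite size_comp_poly2 // sqE lt.
  move=> /(shift_invariant_poly charD)[a qa].
  have a0 : a != 0 by rewrite -polyC_eq0 -qa.
  have a1 : a = 1 by move: q1; rewrite -sqE qa size_polyC a0 coefC.
  by move: Iq; rewrite qa a1 rmorph1.
Qed.

End Operators.
End Fractions.

(** * The ring D and its specialization *)

Section BaseRing.
Variables (C : fieldType) (Dc : idomainType) (dDc : derivation Dc).
Local Notation K := (ratfun {fraction Dc}).
Variables (sK : automorphism K) (dK : derivation K).
Hypotheses (sK_cst : forall a, sK (ratC _ a) = ratC _ a).
Hypothesis (sK_x : sK (ratvar _) = ratvar _ + 1).
Hypothesis (dK_cst : forall a : Dc, dK (cstK Dc a) = cstK Dc (dDc a)).
Hypothesis (dK_x : dK (ratvar _) = 0).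
Variables (h : {poly Dc}) (h_neq0 : h != 0).

Lemma sK_inj : injective sK.
Proof. exact: bij_inj (aut_bij sK). Qed.

Lemma polyK_in_D p : polyK Dc p \in in_D sK h.
Proof. by apply: gen_subring_sub; left; exists p. Qed.

Lemma shifts_next (g : K) : shifts sK (polyK Dc h) g -> shifts sK (polyK Dc h) (sK g).
Proof.
move=> [[|i] [->|e]]; [by exists 1; left| | |].
- by exists 1; left; rewrite -e.
- by exists i.+2; left; rewrite iterS.
- by exists i; right; rewrite -e iterSr.
Qed.

(** For p = h this exhibits the backward shifts of h as images of polynomials. *)
Lemma iter_unshift i p : iter i sK (polyK Dc (p \Po ('X - i%:R))) = polyK Dc p.
Proof.
elim: i p => [|i IH] p; first by rewrite subr0 comp_polyXr.
rewrite iterSr (sK_polyK sK_cst sK_x) -comp_polyA -[RHS]IH.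
congr (iter i sK (polyK Dc _)); congr (p \Po _).
rewrite comp_polyD comp_polyX -polyC_natr -polyCN comp_polyC polyCN polyC_natr.
by rewrite mulrS; ring.
Qed.

Lemma shifts_polyK g : shifts sK (polyK Dc h) g -> exists2 q, q != 0 & g = polyK Dc q.
Proof.
move=> [i [->|e]].
  elim: i => [|i [q q0 IH]]; first by exists h.
  rewrite iterS IH (sK_polyK sK_cst sK_x); exists (q \Po ('X + 1)) => //.
  by rewrite -polyK_eq0 -(sK_polyK sK_cst sK_x) fmorph_eq0 polyK_eq0.
have iter_inj : injective (iter i sK).
  by elim: i {e} => [|i IH] x y //= /sK_inj/IH.
have ge : g = polyK Dc (h \Po ('X - i%:R)).
  by apply: iter_inj; rewrite e iter_unshift.
exists (h \Po ('X - i%:R)) => //; rewrite -polyK_eq0 -ge.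
move: h_neq0; rewrite -polyK_eq0; apply: contraNneq => g0; rewrite -e g0.
by apply/eqP; elim: i {iter_inj ge e} => [|i IH]; [|rewrite iterS IH raddf0].
Qed.

Lemma in_D_derivation f : f \in in_D sK h -> dK f \in in_D sK h.
Proof.
move=> fD; suff [] : f \in in_D sK h /\ dK f \in in_D sK h by [].
move: f fD; apply: gen_subring_ind.
- by rewrite derivation1 rpred0 rpred1.
- by move=> a b [aD da] [bD db]; rewrite raddfB !rpredB.
- by move=> a b [aD da] [bD db]; rewrite derM rpredD ?rpredM.
- move=> _ [[p _ <-]|[g gs <-]].
    by rewrite (dK_polyK dK_cst dK_x); split; apply: polyK_in_D.
  have gV : g^-1 \in in_D sK h by apply: gen_subring_sub; right; exists g.
  have [q q0 gq] := shifts_polyK gs.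
  have g0 : g != 0.
    by rewrite gq polyK_eq0.
  split=> //; rewrite derivationV ?unitfE // rpredN !rpredM //.
  by rewrite gq (dK_polyK dK_cst dK_x) polyK_in_D.
Qed.

Variables (c1 : {rmorphism Dc -> C}) (c1D : {rmorphism ringD sK h -> ratfun C}).
Hypothesis (c1D_poly : forall (p : {poly Dc}) (a : ringD sK h),
  val a = polyK Dc p -> c1D a = tofrac (map_poly c1 p)).
Variable (sC : {rmorphism ratfun C -> ratfun C}).
Hypothesis (sC_cst : forall c, sC (ratC _ c) = ratC _ c).
Hypothesis (sC_x : sC (ratvar _) = ratvar _ + 1).

Lemma c1D_inv (a b : ringD sK h) : val a * val b = 1 -> c1D a * c1D b = 1.
Proof.
move=> ab; rewrite -rmorphM; have e : a * b = 1.
  apply: val_inj; rewrite rmorphM rmorph1; exact: ab.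
rewrite e; exact: rmorph1.
Qed.

(** The specialization commutes with sigma.  On the inverse of a shift of h this
    is forced by uniqueness of inverses. *)
Lemma c1D_sigma (r : ringD sK h) :
  exists b : ringD sK h, val b = sK (val r) /\ c1D b = sC (c1D r).
Proof.
suff : forall f, f \in in_D sK h -> exists a b : ringD sK h,
    [/\ val a = f, val b = sK f & c1D b = sC (c1D a)].
  move=> /(_ _ (valP r))[a' [b [aa' bs cb]]]; exists b; split => //.
  by rewrite cb; congr (sC (c1D _)); apply: val_inj.
have poly_case p : exists a b : ringD sK h,
    [/\ val a = polyK Dc p, val b = sK (polyK Dc p) & c1D b = sC (c1D a)].
  exists (SubringOf (polyK_in_D p)), (SubringOf (polyK_in_D (p \Po ('X + 1)))).
  split=> //; first by rewrite (sK_polyK sK_cst sK_x).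
  rewrite (c1D_poly (a := SubringOf (polyK_in_D p)) (p := p) erefl).
  rewrite (c1D_poly (a := SubringOf (polyK_in_D _)) (p := p \Po ('X + 1)) erefl).
  rewrite (tofrac_shift sC_cst sC_x) map_comp_poly.
  by rewrite rmorphD rmorph1 /= map_polyX.
apply: gen_subring_ind.
- by exists 1, 1; rewrite !rmorph1.
- move=> f g [a [b [<- bs cb]]] [a' [b' [<- bs' cb']]].
  by exists (a - a'), (b - b'); split; rewrite !rmorphB //= ?bs ?bs' ?cb ?cb'.
- move=> f g [a [b [<- bs cb]]] [a' [b' [<- bs' cb']]].
  by exists (a * a'), (b * b'); split; rewrite !rmorphM //= ?bs ?bs' ?cb ?cb'.
- move=> _ [[p _ <-]|[g gs <-]]; first exact: poly_case.
  have gV g' : shifts sK (polyK Dc h) g' -> g'^-1 \in in_D sK h.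
    by move=> gs'; apply: gen_subring_sub; right; exists g'.
  have [q q0 gq] := shifts_polyK gs.
  have g0 : g != 0.
    by rewrite gq polyK_eq0.
  have [a [b [ag bs cb]]] := poly_case q; rewrite -gq in ag bs.
  pose a' : ringD sK h := SubringOf (gV _ gs).
  pose b' : ringD sK h := SubringOf (gV _ (shifts_next gs)).
  have a'g : val a' = g^-1 by [].
  have b's : val b' = (sK g)^-1 by [].
  exists a', b'; split=> //; first by rewrite b's fmorphV.
  have sg0 : sK g != 0 by rewrite fmorph_eq0.
  have aa' : c1D a * c1D a' = 1 by apply: c1D_inv; rewrite a'g ag (mulfV g0).
  have bb' : c1D b * c1D b' = 1 by apply: c1D_inv; rewrite b's bs (mulfV sg0).
  clear a'g b's sg0.
  have cb0 : c1D b != 0.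
    by apply: contra_eqN bb' => /eqP->; rewrite mul0r eq_sym oner_eq0.
  by apply: (mulfI cb0); rewrite bb' cb -rmorphM aa' rmorph1.
Qed.

(** The local ring of k0(x) at the kernel of the specialization.  It is used in
    place of D because det A is invertible in it; D itself need not contain
    the inverse of det A. *)
Definition regular : set K :=
  [set f | exists d e : ringD sK h, c1D d != 0 /\ val d * f = val e].

Lemma regular_sub f : f \in in_D sK h -> regular f.
Proof.
by move=> fD; exists 1, (SubringOf fD); rewrite !rmorph1 oner_neq0 mul1r.
Qed.

Lemma regular_sigma f : regular f -> regular (sK f).
Proof.
move=> [d [e [d0 df]]].
have [d' [ds cd]] := c1D_sigma d; have [e' [es _]] := c1D_sigma e.
exists d', e'; rewrite cd fmorph_eq0; split=> //.
by rewrite ds es -df rmorphM.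
Qed.

Lemma regular_derivation f : regular f -> regular (dK f).
Proof.
move=> [d [e [d0 df]]].
pose d' : ringD sK h := SubringOf (in_D_derivation (valP d)).
pose e' : ringD sK h := SubringOf (in_D_derivation (valP e)).
exists (d * d), (d * e' - d' * e); rewrite rmorphM mulf_neq0 //; split=> //.
have d'E : val d' = dK (val d) by [].
have e'E : val e' = dK (val e) by [].
rewrite valB !valM d'E e'E -df derM.
move: (val d) (dK _) (dK f) => x x' f'.
by rewrite mulrDr mulrCA addrAC subrr add0r mulrA.
Qed.

End BaseRing.

(** * The graph of X |-> X N *)

Lemma pair_sum (R : comNzRingType) n (F G : 'I_n -> R) :
  (\sum_k F k, \sum_k G k) = \sum_k (F k, G k) :> R * R.
Proof. by rewrite [RHS]surjective_pairing (raddf_sum fst) (raddf_sum snd). Qed.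

Section LinearSystem.
Variables (K : fieldType) (sK : automorphism K) (dK : derivation K).
Variables (n : nat) (A B : 'M[K]_n) (A_unit : A \in unitmx).
Variables (R : comUnitRingType) (sR : automorphism R) (dR : derivation R).
Variable (iK : {rmorphism K -> R}).
Hypotheses (sR_K : forall f, sR (iK f) = iK (sK f)).
Hypotheses (dR_K : forall f, dR (iK f) = iK (dK f)).
Hypothesis (R_simple : simple_ring [set (sR : R -> R); (dR : R -> R)]).
Variables (X : 'M[R]_n) (X_unit : X \in unitmx).
Hypothesis (sR_X : map_mx sR X = map_mx iK A *m X).
Hypothesis (dR_X : map_mx dR X = map_mx iK B *m X).
Hypothesis (R_gen : forall r, r \in gen_subring (matrix_gens (range iK) X)).

Lemma map_derM (S1 : comNzRingType) (d : derivation S1) p q r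
    (U : 'M[S1]_(p, q)) (V : 'M[S1]_(q, r)) :
  map_mx d (U *m V) = map_mx d U *m V + U *m map_mx d V.
Proof.
apply/matrixP => i j; rewrite !mxE raddf_sum -big_split /=.
by apply: eq_bigr => k _; rewrite derM !mxE.
Qed.

Variable N : 'M[K]_n.
Hypotheses (N_unit : N \in unitmx) (sN : map_mx sK N = N) (dN : map_mx dK N = 0).

Variables (Y : 'M[R]_n) (YE : Y = X *m map_mx iK N).

Lemma NR_unit : map_mx iK N \in unitmx.
Proof. by rewrite map_unitmx. Qed.

Lemma Y_unit : Y \in unitmx.
Proof. by rewrite YE unitmx_mul X_unit NR_unit. Qed.

Lemma map_sR_K p q (U : 'M[K]_(p, q)) : map_mx sR (map_mx iK U) = map_mx iK (map_mx sK U).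
Proof. by apply/matrixP => i j; rewrite !mxE. Qed.

Lemma map_dR_K p q (U : 'M[K]_(p, q)) : map_mx dR (map_mx iK U) = map_mx iK (map_mx dK U).
Proof. by apply/matrixP => i j; rewrite !mxE. Qed.

Lemma sR_Y : map_mx sR Y = map_mx iK A *m Y.
Proof. by rewrite YE map_mxM sR_X map_sR_K sN mulmxA. Qed.

Lemma dR_Y : map_mx dR Y = map_mx iK B *m Y.
Proof. by rewrite YE map_derM dR_X map_dR_K dN map_mx0 mulmx0 addr0 mulmxA. Qed.

(** The subring of R x R generated by these pairs is the relation that a
    morphism over B0 sending X to Y would have as its graph. *)
Definition graph_gens (B0 : set K) : set (R * R) :=
  [set (iK f, iK f) | f in B0] `|` [set z | exists i j, z = (X i j, Y i j)]
  `|` [set ((\det X)^-1, (\det Y)^-1)].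

Local Notation graph B0 := (gen_subring (graph_gens B0)).

Lemma graph_K (B0 : set K) f : B0 f -> (iK f, iK f) \in graph B0.
Proof. by move=> Bf; apply: gen_subring_sub; left; left; exists f. Qed.

Lemma graph_X B0 i j : (X i j, Y i j) \in graph B0.
Proof. by apply: gen_subring_sub; left; right; exists i, j. Qed.

Lemma graph_detV B0 : ((\det X)^-1, (\det Y)^-1) \in graph B0.
Proof. by apply: gen_subring_sub; right. Qed.

Lemma graph_mulmx (B0 : set K) (U : 'M[K]_n) : (forall i j, B0 (U i j)) ->
  forall i j, ((map_mx iK U *m X) i j, (map_mx iK U *m Y) i j) \in graph B0.
Proof.
move=> BU i j; rewrite !mxE.
rewrite pair_sum; apply: rpred_sum => k _; rewrite mxE.
exact: (rpredM (graph_K (BU i k)) (graph_X B0 k j)).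
Qed.

Lemma graph_sigma (B0 : set K) : (forall f, B0 f -> B0 (sK f)) ->
  (forall i j, B0 (A i j)) -> B0 (\det A)^-1 ->
  forall z, z \in graph B0 -> (sR z.1, sR z.2) \in graph B0.
Proof.
move=> Bs BA BdA; apply: gen_subring_ind.
- by rewrite /= !rmorph1; apply: rpred1.
- by move=> a b sa sb; rewrite /= !rmorphB; apply: (rpredB sa sb).
- by move=> a b sa sb; rewrite /= !rmorphM; apply: (rpredM sa sb).
- move=> _ [[[f Bf <-]|[i [j ->]]]|->] /=.
  + by rewrite sR_K; apply/graph_K/Bs.
  + have -> : sR (X i j) = (map_mx iK A *m X) i j by rewrite -sR_X mxE.
    have -> : sR (Y i j) = (map_mx iK A *m Y) i j by rewrite -sR_Y mxE.
    exact: graph_mulmx.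
  + have dA : \det (map_mx iK A) \is a GRing.unit by rewrite -unitmxE map_unitmx.
    have dX : \det X \is a GRing.unit by rewrite -unitmxE.
    have dY : \det Y \is a GRing.unit by rewrite -unitmxE Y_unit.
    rewrite !rmorphV // -!det_map_mx sR_X sR_Y !det_mulmx !invrM //.
    rewrite det_map_mx -fmorphV.
    exact: (rpredM (graph_detV _) (graph_K BdA)).
Qed.

Lemma graph_delta (B0 : set K) : (forall f, B0 f -> B0 (dK f)) ->
  (forall i j, B0 (B i j)) ->
  forall z, z \in graph B0 -> (dR z.1, dR z.2) \in graph B0.
Proof.
move=> Bd BB.
have sub a b : (dR a.1, dR a.2) \in graph B0 -> (dR b.1, dR b.2) \in graph B0 ->
    (dR (a - b).1, dR (a - b).2) \in graph B0.
  by move=> da db; rewrite /= !raddfB; apply: (rpredB da db).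
have mul a b : a \in graph B0 -> b \in graph B0 ->
    (dR a.1, dR a.2) \in graph B0 -> (dR b.1, dR b.2) \in graph B0 ->
    (dR (a * b).1, dR (a * b).2) \in graph B0.
  move=> ga gb da db; rewrite /= !derM.
  by apply: (rpredD (rpredM da gb) (rpredM ga db)).
have dX i j : (dR (X i j), dR (Y i j)) \in graph B0.
  have -> : dR (X i j) = (map_mx iK B *m X) i j by rewrite -dR_X mxE.
  have -> : dR (Y i j) = (map_mx iK B *m Y) i j by rewrite -dR_Y mxE.
  exact: graph_mulmx.
have one : (dR (1 : R * R).1, dR (1 : R * R).2) \in graph B0.
  by rewrite /= !derivation1; apply: rpred0.
(* Stability need not pass to a generated subring through products unless the
   elements lie in the graph themselves, hence the conjunction. *)
pose P : set (R * R) := [set z | z \in graph B0 /\ (dR z.1, dR z.2) \in graph B0].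
have ddet : (dR (\det X), dR (\det Y)) \in graph B0.
  pose Z : 'M[R * R]_n := \matrix_(i, j) (X i j, Y i j).
  have detZ : \det Z \in gen_subring P.
    apply: det_in_subring => i j; rewrite mxE; apply: gen_subring_sub.
    by split; [apply: graph_X|apply: dX].
  have : P (\det Z).
    move: (\det Z) detZ; apply: gen_subring_ind => //.
    - by split; [apply: rpred1|].
    - by move=> a b [ga da] [gb db]; split; [apply: rpredB|apply: sub].
    - by move=> a b [ga da] [gb db]; split; [apply: rpredM|apply: mul].
  have XZ : map_mx fst Z = X by apply/matrixP => i j; rewrite !mxE.
  have YZ : map_mx snd Z = Y by apply/matrixP => i j; rewrite !mxE.
  have e1 : (\det Z).1 = \det X by rewrite -XZ det_map_mx.
  have e2 : (\det Z).2 = \det Y by rewrite -YZ det_map_mx.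
  by move=> [_]; rewrite e1 e2.
move=> z gz; suff [] : P z by [].
move: z gz; apply: gen_subring_ind.
- by split; [apply: rpred1|].
- by move=> a b [ga da] [gb db]; split; [apply: rpredB|apply: sub].
- by move=> a b [ga da] [gb db]; split; [apply: rpredM|apply: mul].
- move=> z gz; split; first exact: gen_subring_sub.
  case: gz => [[[f Bf <-]|[i [j ->]]]|->] //=.
  + by rewrite dR_K; apply/graph_K/Bd.
  + have uX : \det X \is a GRing.unit by rewrite -unitmxE.
    have uY : \det Y \is a GRing.unit by rewrite -unitmxE Y_unit.
    rewrite !derivationV //.
    by apply: (rpredNr (rpredM (rpredM (graph_detV _) (graph_detV _)) ddet)).
Qed.

Lemma graph_total r : exists r', (r, r') \in graph setT.
Proof.
move: r (R_gen r); apply: gen_subring_ind.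
- by exists 1; apply: rpred1.
- by move=> a b [a' ga] [b' gb]; exists (a' - b'); apply: (rpredB ga gb).
- by move=> a b [a' ga] [b' gb]; exists (a' * b'); apply: (rpredM ga gb).
- move=> _ [[[f _ <-]|[i [j ->]]]|->].
  + by exists (iK f); apply: graph_K.
  + by exists (Y i j); apply: graph_X.
  + by exists (\det Y)^-1; apply: graph_detV.
Qed.

Lemma graph_onto r : exists r', (r', r) \in graph setT.
Proof.
move: r (R_gen r); apply: gen_subring_ind.
- by exists 1; apply: rpred1.
- by move=> a b [a' ga] [b' gb]; exists (a' - b'); apply: (rpredB ga gb).
- by move=> a b [a' ga] [b' gb]; exists (a' * b'); apply: (rpredM ga gb).
- move=> _ [[[f _ <-]|[i [j ->]]]|->].
  + by exists (iK f); apply: graph_K.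
  + have -> : X = Y *m map_mx iK (invmx N).
      by rewrite YE -mulmxA -map_mxM mulmxV // map_mx1 mulmx1.
    exists (\sum_k X i k * iK (invmx N k j)).
    rewrite mxE pair_sum; apply: rpred_sum => k _; rewrite mxE.
    exact: (rpredM (graph_X setT i k) (@graph_K setT (invmx N k j) I)).
  + have uX : \det X \is a GRing.unit by rewrite -unitmxE.
    have uN : \det (map_mx iK N) \is a GRing.unit by rewrite -unitmxE NR_unit.
    exists ((\det X)^-1 * iK (\det N)).
    have e : (\det X)^-1 = (\det Y)^-1 * iK (\det N).
      by rewrite YE det_mulmx mulrC invrM // mulrA -det_map_mx divrr // mul1r.
    have gX := graph_detV setT; have gN := @graph_K setT (\det N) I.
    by have := rpredM gX gN; rewrite [_ * (iK _, _)]surjective_pairing /= -e.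
Qed.

(** Only the diagonal generators of the graph change with B0, and they can be
    multiplied into B0; Q is a multiplicative set of denominators. *)
Lemma graph_denominators (Q B0 : set K) : Q 1 -> (forall p q, Q p -> Q q -> Q (p * q)) ->
  (forall p, Q p -> B0 p) ->
  (forall f, exists p, Q p /\ B0 (p * f)) ->
  forall z, z \in graph setT ->
    exists p, Q p /\ (iK p * z.1, iK p * z.2) \in graph B0.
Proof.
move=> Q1 QM QB Qden.
have scale p a b : Q p -> (a, b) \in graph B0 -> (iK p * a, iK p * b) \in graph B0.
  by move=> /QB Bp gab; apply: (rpredM (graph_K Bp) gab).
apply: gen_subring_ind.
- by exists 1; rewrite /= rmorph1 !mulr1; split=> //; apply: rpred1.
- move=> a b [p [Qp ga]] [q [Qq gb]]; exists (p * q); split; first exact: QM.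
  have e c c' : iK q * (iK p * c) - iK p * (iK q * c') = iK (p * q) * (c - c').
    by rewrite rmorphM; ring.
  have := rpredB (scale _ _ _ Qq ga) (scale _ _ _ Qp gb).
  by rewrite [_ - _]surjective_pairing /= !e.
- move=> a b [p [Qp ga]] [q [Qq gb]]; exists (p * q); split; first exact: QM.
  have e c c' : (iK p * c) * (iK q * c') = iK (p * q) * (c * c').
    by rewrite rmorphM; ring.
  by have := rpredM ga gb; rewrite [_ * (_, _)]surjective_pairing /= !e.
- move=> z gz; have [[f _ zf]|zn] := pselect (exists2 f, setT f & (iK f, iK f) = z).
    have [p [Qp Bpf]] := Qden f; exists p; split=> //.
    by rewrite -zf /= -rmorphM; apply: graph_K.
  exists 1; split=> //; rewrite rmorph1 !mul1r -surjective_pairing.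
  apply: gen_subring_sub; case: gz => [[zf|zX]|zd]; [by case: zn|by left; right|by right].
Qed.

(** The second coordinates of the elements (0, r) of the graph form an ideal
    stable under both operators.  As R is simple this ideal vanishes unless it
    contains 1, and then the graph is that of a morphism. *)
Lemma graph_automorphism : (0, 1) \notin graph setT ->
  exists t : {rmorphism R -> R}, [/\ forall f, t (iK f) = iK f, map_mx t X = Y,
    forall r, t (sR r) = sR (t r) & forall r, t (dR r) = dR (t r)].
Proof.
move=> g01; pose I0 := [set r | (0, r) \in graph setT].
have I0_ideal : is_ideal I0.
  split; first exact: rpred0.
  - move=> a b ga gb; have := rpredD ga gb.
    by rewrite /I0 /= [(0, a) + _]surjective_pairing /= addr0.
  - move=> a b gb; have [a' ga] := graph_onto a; have := rpredM ga gb.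
    by rewrite /I0 /= [_ * (0, b)]surjective_pairing /= mulr0.
have gs : forall z, z \in graph setT -> (sR z.1, sR z.2) \in graph setT.
  by apply: graph_sigma.
have gd : forall z, z \in graph setT -> (dR z.1, dR z.2) \in graph setT.
  by apply: graph_delta.
have I0_zero : I0 = [set 0].
  have [_ [->|->]|e|IT] := R_simple I0_ideal; last 2 first.
  - exact: e.
  - by case/negP: g01; have : I0 1 by rewrite IT.
  - by move=> r /gs; rewrite /= rmorph0.
  - by move=> r /gd; rewrite /= raddf0.
have uniq r a b : (r, a) \in graph setT -> (r, b) \in graph setT -> a = b.
  move=> ga gb; apply/eqP; rewrite -subr_eq0; apply/eqP.
  have := rpredB ga gb; rewrite [_ - _]surjective_pairing /= subrr => g0.
  by have : I0 (a - b) by []; rewrite I0_zero.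
have [|a b a' b' ga gb|a b a' b' ga gb||b gb|t gt] :=
    @graph_rmorph R R (fun a b => (a, b) \in graph setT).
- exact: rpred1.
- exact: (rpredB ga gb).
- exact: (rpredM ga gb).
- exact: graph_total.
- by apply: (uniq 0) gb _; apply: rpred0.
exists t; split.
- by move=> f; apply: (uniq (iK f)) (gt _) _; apply: graph_K.
- by apply/matrixP => i j; rewrite mxE; apply: (uniq (X i j)) (gt _) _; apply: graph_X.
- by move=> r; apply: (uniq (sR r)) (gt _) _; have := gs _ (gt r).
- by move=> r; apply: (uniq (dR r)) (gt _) _; have := gd _ (gt r).
Qed.

End LinearSystem.

(** * Operators on the quotient by a maximal sigma-ideal *)

Section QuotientOperators.
Variables (T : comNzRingType) (m : idealr T).
Local Notation Q := {ideal_quot m}.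
Local Notation piQ := (\pi_{ideal_quot m}%qT : T -> Q).

Lemma pi_eq t u : piQ t = piQ u <-> t - u \in m.
Proof. by rewrite Quotient.idealrBE; split=> [->|/eqP]. Qed.

Lemma pi_eq0 t : piQ t = 0 <-> t \in m.
Proof.
have := pi_eq t 0; rewrite subr0 => <-.
by have -> : piQ 0 = 0 by exact: rmorph0.
Qed.

Lemma quot_opE (f : {additive T -> T}) : stable f [set` m] ->
  forall t, quot_op f (piQ t) = piQ (f t).
Proof.
move=> fm t; apply/pi_eq; rewrite -raddfB; apply: fm => /=.
by apply/pi_eq; rewrite reprK.
Qed.

Lemma quot_op_rmorphism (f : {rmorphism T -> T}) : stable f [set` m] ->
  exists g : {rmorphism Q -> Q}, forall y, g y = quot_op f y.
Proof.
move=> fm; have qE t : quot_op f (piQ t) = piQ (f t) by exact: quot_opE fm t.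
have piK y : exists t, piQ t = y by exists (repr y); rewrite reprK.
have piB t u : piQ t - piQ u = piQ (t - u) by rewrite -rmorphB.
have piM t u : piQ t * piQ u = piQ (t * u) by rewrite -rmorphM.
have pi1 : 1 = piQ 1 by exact/esym/rmorph1.
have qB : zmod_morphism (@quot_op _ m f).
  move=> a b; have [t <-] := piK a; have [u <-] := piK b.
  by rewrite piB !qE piB (rmorphB f).
have qM : monoid_morphism (@quot_op _ m f).
  split; first by rewrite {1}pi1 qE (rmorph1 f).
  move=> a b; have [t <-] := piK a; have [u <-] := piK b.
  by rewrite piM !qE piM (rmorphM f).
pose F1 := GRing.isZmodMorphism.Build Q Q (@quot_op _ m f) qB.
pose F2 := GRing.isMonoidMorphism.Build Q Q (@quot_op _ m f) qM.
by exists (HB.pack_for {rmorphism Q -> Q} (@quot_op _ m f) F1 F2).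
Qed.

Lemma quot_automorphism (rho : automorphism T) :
  (forall t, (rho t \in m) = (t \in m)) ->
  exists tau : automorphism Q, forall t, tau (piQ t) = piQ (rho t).
Proof.
move=> rhom; have [rho' rhoK rho'K] := aut_bij rho.
have rho_stable : stable rho [set` m] by move=> t; rewrite /= rhom.
have [tau tauE] := quot_op_rmorphism rho_stable.
have tau_pi t : tau (piQ t) = piQ (rho t) by rewrite tauE quot_opE.
have tau_bij : bijective tau.
  exists (fun y => piQ (rho' (repr y))) => y; last by rewrite tau_pi rho'K reprK.
  rewrite -[y in RHS]reprK; apply/pi_eq; rewrite -rhom rmorphB rho'K.
  by apply/pi_eq; rewrite -tau_pi !reprK.
by exists (Automorphism tau_bij).
Qed.

Variable s : {rmorphism T -> T}.

Lemma maximal_sigma_ideal_simple : maximal_sigma_ideal s m ->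
  forall J : set Q, is_ideal J -> stable (quot_op s) J -> ~ J 1 ->
  forall y, J y -> y = 0.
Proof.
move=> [sm mmax] J [J0 JD JM] Js J1 y Jy.
pose J' := [set t | J (piQ t)].
have J'm : J' = [set` m].
  apply: mmax.
  - split; first by rewrite /J' /= (rmorph0 \pi_{ideal_quot m}%qT).
    + by move=> a b Ja Jb; rewrite /J' /= (rmorphD \pi_{ideal_quot m}%qT); apply: JD.
    + by move=> a b Jb; rewrite /J' /= (rmorphM \pi_{ideal_quot m}%qT); apply: JM.
  - by move=> t /Js; rewrite quot_opE.
  - by rewrite /J' /= (rmorph1 \pi_{ideal_quot m}%qT).
  - by move=> t /pi_eq0 t0; rewrite /J' /= t0.
have : J' (repr y) by rewrite /J' /= reprK.
by rewrite J'm /= => /pi_eq0; rewrite reprK.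
Qed.

End QuotientOperators.

(** * Lifting endomorphisms of a specialization to R *)

Section SpecializedRing.
Variables (C : closedFieldType) (char0 : forall n, (n%:R == 0 :> C) = (n == 0)%N).
Variables (Dc : idomainType) (dDc : derivation Dc) (iC : {rmorphism C -> Dc}).
Local Notation K := (ratfun {fraction Dc}).
Hypothesis (dDc_C : forall c, dDc (iC c) = 0).
Hypothesis (Dc_simple : simple_ring [set dDc : Dc -> Dc]).
Variables (sK : automorphism K) (dK : derivation K).
Hypotheses (sK_cst : forall a, sK (ratC _ a) = ratC _ a).
Hypothesis (sK_x : sK (ratvar _) = ratvar _ + 1).
Hypothesis (dK_cst : forall a : Dc, dK (cstK Dc a) = cstK Dc (dDc a)).
Hypothesis (dK_x : dK (ratvar _) = 0).
Variables (n : nat) (A B : 'M[K]_n) (A_unit : A \in unitmx).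
Variables (R : comUnitRingType) (sR : automorphism R) (dR : derivation R).
Variable (iK : {rmorphism K -> R}).
Hypotheses (sR_K : forall f, sR (iK f) = iK (sK f)).
Hypotheses (dR_K : forall f, dR (iK f) = iK (dK f)).
Hypothesis (R_simple : simple_ring [set (sR : R -> R); (dR : R -> R)]).
Variables (X : 'M[R]_n) (X_unit : X \in unitmx).
Hypothesis (sR_X : map_mx sR X = map_mx iK A *m X).
Hypothesis (dR_X : map_mx dR X = map_mx iK B *m X).
Hypothesis (R_gen : forall r, r \in gen_subring (matrix_gens (range iK) X)).
Variables (h : {poly Dc}) (h_neq0 : h != 0).
Hypotheses (A_loc : forall i j, A i j \in localized_at h)
           (B_loc : forall i j, B i j \in localized_at h).
Hypothesis (calR_s : forall r, (sR r \in in_calR sK h iK X) = (r \in in_calR sK h iK X)).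
Hypothesis (calR_d : forall r, r \in in_calR sK h iK X -> dR r \in in_calR sK h iK X).
Variables (c1 : {rmorphism Dc -> C}) (c1_C : forall c, c1 (iC c) = c).
Variables (c1D : {rmorphism ringD sK h -> ratfun C}).
Hypothesis (c1D_poly : forall (p : {poly Dc}) (a : ringD sK h),
  val a = polyK Dc p -> c1D a = tofrac (map_poly c1 p)).
Hypothesis (detA : \det (specialize c1D A) != 0).
Variable (sC : {rmorphism ratfun C -> ratfun C}).
Hypothesis (sC_cst : forall c, sC (ratC _ c) = ratC _ c).
Hypothesis (sC_x : sC (ratvar _) = ratvar _ + 1).

Local Notation D := (ringD sK h).
Local Notation cR := (calR sK h iK X).
Local Notation toR := (D_to_calR sK h iK X).
Local Notation XR := (X_calR sK h iK X).

Lemma charD k : (k%:R == 0 :> Dc) = (k == 0)%N.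
Proof. by rewrite -(rmorph_nat iC) fmorph_eq0 char0. Qed.

Lemma localized_in_D f : f \in localized_at h -> f \in in_D sK h.
Proof.
rewrite /localized_at; move: f; apply: gen_subring_ind.
- exact: rpred1.
- by move=> a b; apply: rpredB.
- by move=> a b; apply: rpredM.
- move=> _ [[p _ <-]|->]; first exact: polyK_in_D.
  by apply: gen_subring_sub; right; exists (polyK Dc h) => //; exists 0; left.
Qed.

Lemma toR_in (f : K) : f \in in_D sK h -> iK f \in in_calR sK h iK X.
Proof. by move=> fD; have := valP (toR (SubringOf fD)). Qed.

Definition cstD (c : C) : D := SubringOf (polyK_in_D sK h (iC c)%:P).

Lemma val_cstD c : val (cstD c) = (cstK Dc \o iC) c.
Proof. by []. Qed.

Lemma c1D_cstD c : c1D (cstD c) = ratC C c.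
Proof. by rewrite (c1D_poly (p := (iC c)%:P)) // map_polyC /= c1_C. Qed.

Lemma detV_in_calR : (\det X)^-1 \in in_calR sK h iK X.
Proof. by apply: gen_subring_sub; right. Qed.

Definition detV : cR := SubringOf detV_in_calR.

Lemma calR_ind (P : cR -> Prop) :
  P 1 -> (forall a b, P a -> P b -> P (a - b)) ->
  (forall a b, P a -> P b -> P (a * b)) ->
  (forall a : D, P (toR a)) -> (forall i j, P (XR i j)) -> P detV ->
  forall r, P r.
Proof.
move=> P1 PB PM PD PX Pd r.
suff [r' [/val_inj <-]] : exists r' : cR, val r' = val r /\ P r' by [].
move: (val r) (valP r) => v; move: v {r}; apply: gen_subring_ind.
- by exists 1.
- by move=> _ _ [a [<- Pa]] [b [<- Pb]]; exists (a - b); split; [exact: valB|exact: PB].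
- by move=> _ _ [a [<- Pa]] [b [<- Pb]]; exists (a * b); split; [exact: valM|exact: PM].
- move=> _ [[[f fD <-]|[i [j ->]]]|->].
  + by exists (toR (SubringOf fD)).
  + by exists (XR i j); split; [rewrite mxE|exact: PX].
  + by exists detV.
Qed.

Lemma val_XR : map_mx val XR = X.
Proof. by apply/matrixP => i j; rewrite !mxE. Qed.

Lemma det_XR_detV : \det XR * detV = 1.
Proof.
apply: val_inj; rewrite [LHS]valM [RHS]val1 -det_map_mx val_XR.
by apply: mulrV; rewrite -unitmxE.
Qed.

Definition AD : 'M[D]_n := \matrix_(i, j) SubringOf (localized_in_D (A_loc i j)).

Lemma specialize_A : specialize c1D A = map_mx c1D AD.
Proof.
apply/matrixP => i j; rewrite !mxE; congr (c1D _); apply: val_inj.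
by rewrite insubdK //; apply: localized_in_D.
Qed.

Lemma val_AD : map_mx val AD = A.
Proof. by apply/matrixP => i j; rewrite !mxE. Qed.

Section Lift.
Variables (S : comNzRingType) (psi : {rmorphism cR -> S}).
Variables (iota : {rmorphism ratfun C -> S}).
Hypothesis psi_D : forall a : D, psi (toR a) = iota (c1D a).
Variables (tau : {rmorphism S -> S}) (tau_iota : forall f, tau (iota f) = iota f).
Variables (M : 'M[C]_n) (M_unit : M \in unitmx).
Hypothesis (tau_X : map_mx tau (map_mx psi XR)
  = map_mx psi XR *m map_mx (fun c => iota (ratC C c)) M).

Let N : 'M[K]_n := map_mx (cstK Dc \o iC) M.
Let Y := X *m map_mx iK N.

Let YR := XR *m map_mx (fun c => toR (cstD c)) M.
Let detVY : cR := detV * toR (cstD (\det M)^-1).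

Lemma psi_cst c : psi (toR (cstD c)) = iota (ratC C c).
Proof. by rewrite psi_D c1D_cstD. Qed.

Lemma val_toR (a : D) : val (toR a) = iK (val a).
Proof. by []. Qed.

Lemma val_YR i j : val (YR i j) = Y i j.
Proof.
rewrite !mxE raddf_sum; apply: eq_bigr => k _.
by rewrite !mxE [LHS]valM.
Qed.

Lemma tau_XR i j : tau (psi (XR i j)) = psi (YR i j).
Proof.
have := congr1 (fun Z : 'M[S]_n => Z i j) tau_X.
rewrite ![map_mx _ _ i j]mxE => ->.
rewrite !mxE rmorph_sum; apply: eq_bigr => k _.
by rewrite rmorphM ![map_mx _ _ _ _]mxE psi_cst.
Qed.

Lemma val_detVY : val detVY = (\det Y)^-1.
Proof.
have uX : \det X \is a GRing.unit by rewrite -unitmxE.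
have uM : \det M \is a GRing.unit by rewrite -unitmxE.
rewrite /detVY /Y [LHS]valM val_toR val_cstD det_mulmx /N !det_map_mx.
rewrite [RHS]invrM //; last by do 2!apply: rmorph_unit.
rewrite [RHS]mulrC; congr (_ * _).
exact: (fmorphV (iK \o (cstK Dc \o iC)) (\det M)).
Qed.

Lemma det_YR : \det YR * detVY = 1.
Proof.
have uY : \det Y \is a GRing.unit.
  rewrite -unitmxE unitmx_mul X_unit /= map_unitmx.
  by rewrite unitmxE unitfE det_map_mx fmorph_eq0 -unitfE -unitmxE.
have YE : map_mx val YR = Y by apply/matrixP => i j; rewrite mxE val_YR.
apply: val_inj; rewrite [LHS]valM [RHS]val1 -det_map_mx YE val_detVY.
exact: mulrV.
Qed.

Lemma tau_detV : tau (psi detV) = psi detVY.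
Proof.
have e1 : tau (psi (\det XR)) = psi (\det YR).
  rewrite -!det_map_mx; congr (\det _); apply/matrixP => i j.
  rewrite [LHS]mxE [X in tau X]mxE [RHS]mxE; exact: tau_XR.
have e2 : psi (\det YR) * tau (psi detV) = 1.
  by rewrite -e1 -!rmorphM det_XR_detV !rmorph1.
have e3 : psi (\det YR) * psi detVY = 1 by rewrite -rmorphM det_YR rmorph1.
by rewrite -[LHS]mul1r -e3 mulrAC e2 mul1r.
Qed.

(** What remains of the relation tau (psi r) = psi r' for pairs that lie in calR
    only up to a denominator; the denominator must survive specialization. *)
Definition compatible (z : R * R) : Prop :=
  exists d r r', [/\ c1D d != 0, val r = iK (val d) * z.1,
    val r' = iK (val d) * z.2 & tau (psi r) = psi r'].

Lemma tau_psi_D a : tau (psi (toR a)) = psi (toR a).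
Proof. by rewrite psi_D tau_iota. Qed.

Lemma compatible1 (r r' : cR) z : val r = z.1 -> val r' = z.2 ->
  tau (psi r) = psi r' -> compatible z.
Proof.
move=> e e' te; exists 1, r, r'; split; last exact: te.
- by rewrite rmorph1 oner_neq0.
- by rewrite e [X in iK X]val1 rmorph1 mul1r.
- by rewrite e' [X in iK X]val1 rmorph1 mul1r.
Qed.

Lemma graph_compatible z :
  z \in gen_subring (graph_gens iK X Y (regular c1D)) -> compatible z.
Proof.
move: z; apply: (@gen_subring_ind _ _ compatible).
- apply: (@compatible1 1 1); first exact: val1.
    exact: val1.
  by rewrite !rmorph1.
- move=> a b [d [r [r' [d0 e e' te]]]] [f [s [s' [f0 g g' tg]]]].
  exists (d * f), (r * toR f - s * toR d), (r' * toR f - s' * toR d).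
  have iKM : iK (val (d * f)) = iK (val d) * iK (val f) by rewrite valM rmorphM.
  have key (p q x y : R) : p * x * q - q * y * p = p * q * (x - y) by ring.
  have vM (x : cR) (y : D) : val (x * toR y) = val x * iK (val y) by exact: valM.
  have vB (x y : cR) : val (x - y) = val x - val y by exact: valB.
  split; first by rewrite rmorphM; exact: mulf_neq0 d0 f0.
  + rewrite iKM vB !vM e g; exact: key.
  + rewrite iKM vB !vM e' g'; exact: key.
  + by rewrite !rmorphB !rmorphM te tg !tau_psi_D.
- move=> a b [d [r [r' [d0 e e' te]]]] [f [s [s' [f0 g g' tg]]]].
  exists (d * f), (r * s), (r' * s').
  have iKM : iK (val (d * f)) = iK (val d) * iK (val f) by rewrite valM rmorphM.
  split; first by rewrite rmorphM; exact: mulf_neq0 d0 f0.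
  + by rewrite [LHS]valM iKM e g; exact: mulrACA.
  + by rewrite [LHS]valM iKM e' g'; exact: mulrACA.
  + by rewrite !rmorphM te tg.
- move=> _ [[[f [d [e [d0 de]]] <-]|[i [j ->]]]|->].
  + by exists d, (toR e), (toR e); rewrite val_toR -de rmorphM tau_psi_D.
  + apply: (@compatible1 (XR i j) (YR i j)); [by rewrite mxE|exact: val_YR|].
    exact: tau_XR.
  + apply: (@compatible1 detV detVY); [by []|exact: val_detVY|exact: tau_detV].
Qed.

(** Compatibility of (0, 1) would force the image of some d, which is invertible,
    to be tau 0 = 0. *)
Lemma specialized_graph01 :
  (0, 1) \notin gen_subring (graph_gens iK X Y (regular c1D)).
Proof.
apply/negP => /graph_compatible[d [r [r' [d0 e e' te]]]].
have r0 : r = 0 by apply: val_inj; rewrite e [RHS]val0; exact: mulr0.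
have r'd : r' = toR d by apply: val_inj; rewrite e' val_toR; exact: mulr1.
move: te; rewrite r0 r'd !rmorph0 psi_D => /esym/eqP.
by rewrite fmorph_eq0 (negPf d0).
Qed.

Lemma regular_A i j : regular c1D (A i j).
Proof. exact/regular_sub/localized_in_D. Qed.

Lemma regular_B i j : regular c1D (B i j).
Proof. exact/regular_sub/localized_in_D. Qed.

Lemma regular_detAV : regular c1D (\det A)^-1.
Proof.
have dA : \det A != 0 by rewrite -unitfE -unitmxE.
exists (\det AD), 1; split; first by rewrite -det_map_mx -specialize_A.
by rewrite -det_map_mx val_AD [RHS]val1 mulfV.
Qed.

Lemma N_unit : N \in unitmx.
Proof. by rewrite map_unitmx. Qed.

Lemma sK_N : map_mx sK N = N.
Proof.
apply/matrixP => i j; rewrite 2!mxE.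
by rewrite -[X in sK X]/(polyK Dc (iC (M i j))%:P) ratC_tofrac sK_cst -ratC_tofrac.
Qed.

Lemma dK_N : map_mx dK N = 0.
Proof.
apply/matrixP => i j; rewrite 3!mxE -[X in dK X]/(cstK Dc (iC (M i j))) dK_cst.
by rewrite dDc_C rmorph0.
Qed.

(** The functions f such that (0, f) is in the graph over the local ring form an
    ideal stable under sigma and delta.  If the graph over K contained (0, 1),
    this ideal would contain a denominator, hence 1, which specialization
    excludes. *)
Lemma graph01 : (0, 1) \notin gen_subring (graph_gens iK X Y setT).
Proof.
apply/negP => g01.
pose Q : set K := [set polyK Dc p | p in [set p | p != 0]].
have regp p : regular c1D (polyK Dc p) by exact/regular_sub/polyK_in_D.
have [||||p [[q q0 qp]]] := graph_denominators (Q := Q) (B0 := regular c1D) _ _ _ _ g01.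
- by exists 1; [exact: oner_neq0|exact: rmorph1].
- move=> _ _ [p p0 <-] [q q0 <-]; exists (p * q); [exact: mulf_neq0|exact: rmorphM].
- by move=> _ [p _ <-].
- move=> f; have [p [q [p0 fq]]] := K_denominator f.
  by exists (polyK Dc p); split; [exists p|rewrite fq].
rewrite mulr0 mulr1 -qp => gq.
have gs := graph_sigma A_unit sR_K X_unit sR_X N_unit sK_N erefl
  (regular_sigma sK_cst sK_x h_neq0 c1D_poly sC_cst sC_x) regular_A regular_detAV.
have gd := graph_delta dR_K X_unit dR_X N_unit dK_N erefl
  (regular_derivation sK_cst sK_x dK_cst dK_x h_neq0 (c1D := c1D)) regular_B.
have : (0, iK 1) \in gen_subring (graph_gens iK X Y (regular c1D)).
  apply: (@stable_ideal_contains1 Dc dDc sK dK sK_cst sK_x dK_cst dK_x Dc_simple charD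
  [set f | (0, iK f) \in gen_subring (graph_gens iK X Y (regular c1D))]) =>
    [f g If Ig|r f If|f If|f If|].
  - have pairD (a b c d : R) : (a, b) + (c, d) = (a + c, b + d) :> R * R by [].
    by have := rpredD If Ig; rewrite pairD addr0 -[iK f + iK g]rmorphD.
  - have pairM (a b c d : R) : (a, b) * (c, d) = (a * c, b * d) :> R * R by [].
    have gr : (iK (polyK Dc r), iK (polyK Dc r))
        \in gen_subring (graph_gens iK X Y (regular c1D)) by exact/graph_K/regp.
    by have := rpredM gr If; rewrite pairM mulr0 -[iK _ * iK f]rmorphM.
  - by have := gs _ If; rewrite [X in (X, _)]rmorph0 [X in (_, X)]sR_K.
  - by have := gd _ If; rewrite [X in (X, _)]raddf0 [X in (_, X)]dR_K.
  - by exists q.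
by rewrite rmorph1 (negPf specialized_graph01).
Qed.

(** The step from the specialized ring back to R: relations among the entries of
    X over k0(x) are still satisfied by the entries of X M. *)
Lemma lift_automorphism : exists t : {rmorphism R -> R},
  [/\ forall f, t (iK f) = iK f, map_mx t X = Y,
    forall r, t (sR r) = sR (t r), forall r, t (dR r) = dR (t r) &
    forall r : cR, exists r' : cR, val r' = t (val r) /\ tau (psi r) = psi r'].
Proof.
have [t [tK tX ts td]] := graph_automorphism A_unit sR_K dR_K R_simple X_unit
  sR_X dR_X R_gen N_unit sK_N dK_N erefl graph01.
have {}tX : map_mx t X = Y by [].
exists t; split=> //; apply: calR_ind.
- by exists 1; rewrite [val _]val1 !rmorph1.
- move=> a b [a' [ea ta]] [b' [eb tb]]; exists (a' - b').
  by rewrite [LHS]valB [X in t X]valB !rmorphB ea eb ta tb.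
- move=> a b [a' [ea ta]] [b' [eb tb]]; exists (a' * b').
  by rewrite [LHS]valM [X in t X]valM !rmorphM ea eb ta tb.
- by move=> a; exists (toR a); rewrite tau_psi_D [in RHS]val_toR tK.
- move=> i j; exists (YR i j); split; last exact: tau_XR.
  by rewrite val_YR -tX mxE; congr (t _); rewrite mxE.
- exists detVY; split; last exact: tau_detV.
  by rewrite val_detVY -tX det_map_mx -[LHS]rmorphV.
Qed.

End Lift.


(** * The sigma-Galois group of the specialized ring *)

Variables (T : comNzRingType) (j1 : {rmorphism ratfun C -> T}).
Variable (j2 : {rmorphism cR -> T}).
Hypothesis (T_tensor : is_tensor_product c1D toR j1 j2).
Variable (sT : automorphism T).
Hypotheses (sT_1 : forall f, sT (j1 f) = j1 (sC f))
           (sT_2 : forall r r' : cR, val r' = sR (val r) -> sT (j2 r) = j2 r').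
Variables (m : idealr T) (m_max : maximal_sigma_ideal sT m).

Local Notation XT := (map_mx j2 XR).
Local Notation Q := {ideal_quot m}.
Local Notation piQ := (\pi_{ideal_quot m}%qT : {rmorphism T -> Q}).
Local Notation cstT M := (map_mx (fun c => j1 (ratC C c)) M).
Local Notation XQ := (Xbar XT m).

Lemma j2_D a : j2 (toR a) = j1 (c1D a).
Proof. by case: T_tensor => ->. Qed.

Lemma T_gen t :
  t \in gen_subring (range j1 `|` [set XT i j | i in setT & j in setT] `|` [set j2 detV]).
Proof.
move: t (tensor_generated T_tensor t); apply: gen_subring_ind.
- exact: rpred1.
- by move=> a b; apply: rpredB.
- by move=> a b; apply: rpredM.
- move=> _ [[f _ <-]|[r _ <-]]; first by apply: gen_subring_sub; left; left; exists f.
  move: r; apply: calR_ind.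
  + by rewrite rmorph1; apply: rpred1.
  + by move=> a b ga gb; rewrite rmorphB; apply: rpredB.
  + by move=> a b ga gb; rewrite rmorphM; apply: rpredM.
  + by move=> a; rewrite j2_D; apply: gen_subring_sub; left; left; exists (c1D a).
  + move=> i j; apply: gen_subring_sub; left; right.
    by exists i => //; exists j; rewrite // mxE.
  + by apply: gen_subring_sub; right.
Qed.

Lemma T_ind (P : T -> Prop) :
  P 1 -> (forall a b, P a -> P b -> P (a - b)) ->
  (forall a b, P a -> P b -> P (a * b)) ->
  (forall f, P (j1 f)) -> (forall i j, P (XT i j)) -> P (j2 detV) ->
  forall t, P t.
Proof.
move=> P1 PB PM Pj PX Pd t; move: t (T_gen t); apply: gen_subring_ind => //.
by move=> _ [[[f _ <-]|[i _ [j _ <-]]]|->].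
Qed.

Lemma det_XT_detV : \det XT * j2 detV = 1.
Proof. by rewrite det_map_mx -rmorphM det_XR_detV rmorph1. Qed.

Lemma sT_XT : map_mx sT XT = map_mx j1 (specialize c1D A) *m XT.
Proof.
apply/matrixP => i j; rewrite [LHS]mxE [X in sT X]mxE.
rewrite (@sT_2 _ (\sum_k toR (AD i k) * XR k j)); last first.
  rewrite raddf_sum /=.
  have := congr1 (fun Z : 'M[R]_n => Z i j) sR_X; rewrite [LHS]mxE => e.
  transitivity (sR (X i j)); last by rewrite mxE.
  rewrite e mxE; apply: eq_bigr => k _.
  by rewrite !mxE.
rewrite rmorph_sum mxE; apply: eq_bigr => k _.
by rewrite rmorphM j2_D specialize_A; congr (_ * _); rewrite !mxE.
Qed.

Lemma eq_rmorph_T (S : comNzRingType) (u v : {rmorphism T -> S}) :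
  (forall f, u (j1 f) = v (j1 f)) -> map_mx u XT = map_mx v XT -> u =1 v.
Proof.
move=> uvj uvX; apply: T_ind => //.
- by rewrite !rmorph1.
- by move=> a b ea eb; rewrite !rmorphB ea eb.
- by move=> a b ea eb; rewrite !rmorphM ea eb.
- by move=> i j; have := congr1 (fun Z : 'M[S]_n => Z i j) uvX; rewrite [LHS]mxE [RHS]mxE.
- have eu : u (\det XT) * u (j2 detV) = 1 by rewrite -rmorphM det_XT_detV rmorph1.
  have ev : u (\det XT) * v (j2 detV) = 1.
    by rewrite -det_map_mx uvX det_map_mx -rmorphM det_XT_detV rmorph1.
  by rewrite -[LHS]mul1r -ev mulrAC eu mul1r.
Qed.

Lemma sT_cst (M : 'M[C]_n) : map_mx sT (cstT M) = cstT M.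
Proof. by apply/matrixP => i j; rewrite !mxE sT_1 sC_cst. Qed.

Lemma rho_sigma (rho : {rmorphism T -> T}) (M : 'M[C]_n) :
  (forall f, rho (j1 f) = j1 f) -> map_mx rho XT = XT *m cstT M ->
  forall t, rho (sT t) = sT (rho t).
Proof.
move=> rj rX; apply: (@eq_rmorph_T _ (rho \o sT) (sT \o rho)).
  by move=> f; rewrite /= sT_1 !rj sT_1.
rewrite (map_mx_comp sT rho) (map_mx_comp rho sT) sT_XT rX !map_mxM.
rewrite sT_XT sT_cst rX -mulmxA.
by congr (_ *m _); apply/matrixP => i j; rewrite !mxE rj.
Qed.

Lemma m_sigma_stable : stable sT [set` m]. Proof. by case: m_max. Qed.

Local Notation psi := (piQ \o j2 : {rmorphism cR -> Q}).
Local Notation iota := (piQ \o j1 : {rmorphism ratfun C -> Q}).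
Local Notation cstQ M := (map_mx (fun c => iota (ratC C c)) M).

Lemma psi_iota a : psi (toR a) = iota (c1D a).
Proof. by rewrite /= j2_D. Qed.

Lemma XQ_psi : map_mx psi XR = XQ.
Proof. exact: map_mx_comp. Qed.

Lemma pi_cst (M : 'M[C]_n) : map_mx piQ (cstT M) = cstQ M.
Proof. by apply/matrixP => i j; rewrite !mxE. Qed.

Lemma represents_pi (rho : {rmorphism T -> T}) (tau : automorphism Q) (M : 'M[C]_n) :
  map_mx rho XT = XT *m cstT M -> (forall t, tau (piQ t) = piQ (rho t)) ->
  represents j1 XT tau M.
Proof.
move=> rX taupi; rewrite /represents.
transitivity (map_mx piQ (map_mx rho XT)).
  by apply/matrixP => i j; rewrite 2!mxE taupi [RHS]mxE [in RHS]mxE.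
by rewrite rX map_mxM pi_cst.
Qed.

Lemma quot_sT t : quot_op sT (piQ t) = piQ (sT t).
Proof. exact: quot_opE m_sigma_stable t. Qed.

(** A point of the stabilizer induces an automorphism of the quotient: the
    preimage of m is a proper ideal containing m, hence equal to m. *)
Lemma stab_automorphism (M : 'M[C]_n) : in_stab j1 XT m M ->
  exists2 tau : automorphism Q, sigma_Gal j1 sT tau & represents j1 XT tau M.
Proof.
move=> [rho [[rj rX] rm]]; have rs := rho_sigma rj rX.
have rhom t : (rho t \in m) = (t \in m).
  have [_ mmax] := m_max; pose J := [set t | rho t \in m].
  have Jm : J = [set` m].
    apply: mmax.
    - split; first by rewrite /J /= rmorph0 rpred0.
      + by move=> a b Ja Jb; rewrite /J /= rmorphD rpredD.
      + by move=> a b Jb; rewrite /J /= rmorphM idealMr.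
    - by move=> t' Jt; rewrite /J /= rs; apply: m_sigma_stable.
    - by rewrite /J /= rmorph1 idealr1.
    - by move=> t'; apply: rm.
  by apply/idP/idP => [h1|/rm//]; have : J t by []; rewrite Jm.
have [tau taupi] := quot_automorphism rhom.
exists tau; last exact: represents_pi rX taupi.
split=> [y|f]; last by rewrite taupi rj.
by rewrite -[y]reprK quot_sT !taupi quot_sT rs.
Qed.

Lemma Q_gen y : y \in gen_subring (range iota `|`
  [set` psi detV :: [seq psi (XR i j) | i <- enum 'I_n, j <- enum 'I_n]]).
Proof.
rewrite -[y]reprK; move: (repr y) => t; move: t; apply: T_ind.
- by rewrite (rmorph1 piQ); apply: rpred1.
- by move=> a b ga gb; rewrite (rmorphB piQ); apply: rpredB.
- by move=> a b ga gb; rewrite (rmorphM piQ); apply: rpredM.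
- by move=> f; apply: gen_subring_sub; left; exists f.
- move=> i j; apply: gen_subring_sub; right; rewrite /= in_cons; apply/orP; right.
  by apply/allpairsP; exists (i, j); rewrite !mem_enum; split=> //=; rewrite mxE.
- by apply: gen_subring_sub; right; rewrite /= in_cons eqxx.
Qed.

Lemma quotient_constants y : quot_op sT y = y -> exists c, y = iota (ratC C c).
Proof.
move=> sy; have [phi phiE] := quot_op_rmorphism m_sigma_stable.
apply: (sigma_constants char0 sC_cst sC_x (phi := phi) _ _ Q_gen).
- by move=> f; rewrite phiE -[iota f]/(piQ (j1 f)) quot_sT sT_1.
- move=> J idJ Js; apply: (maximal_sigma_ideal_simple m_max idJ) => z /Js.
  by rewrite phiE.
- by rewrite phiE.
Qed.

(** The matrix Xbar^-1 tau(Xbar) is fixed by sigma, since Xbar and tau(Xbar)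
    satisfy the same invertible linear system. *)
Lemma gal_represented (tau : automorphism Q) : sigma_Gal j1 sT tau ->
  exists2 M : 'M[C]_n, M \in unitmx & represents j1 XT tau M.
Proof.
move=> [taus tauj]; have [phi phiE] := quot_op_rmorphism m_sigma_stable.
have phi_tau y : phi (tau y) = tau (phi y) by rewrite !phiE taus.
have phi_pi t : phi (piQ t) = piQ (sT t) by rewrite phiE quot_sT.
set AC := specialize c1D A.
have phiX : map_mx phi XQ = map_mx iota AC *m XQ.
  transitivity (map_mx piQ (map_mx sT XT)).
    by apply/matrixP => i j; rewrite 2!mxE phi_pi [RHS]mxE [in RHS]mxE.
  by rewrite sT_XT map_mxM -map_mx_comp.
pose d := piQ (j2 detV).
have Xd : \det XQ * d = 1 by rewrite /d det_map_mx -rmorphM det_XT_detV rmorph1.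
pose V := d *: \adj XQ.
have XV : XQ *m V = 1%:M by rewrite -scalemxAr mul_mx_adj scale_scalar_mx mulrC Xd.
have VX : V *m XQ = 1%:M by rewrite -scalemxAl mul_adj_mx scale_scalar_mx mulrC Xd.
pose MQ := V *m map_mx tau XQ.
have XM : XQ *m MQ = map_mx tau XQ by rewrite mulmxA XV mul1mx.
have AC_unit : AC \in unitmx by rewrite unitmxE unitfE.
have phiM : map_mx phi MQ = MQ.
  have tau_iota f : tau (iota f) = iota f by exact: tauj.
  have : map_mx phi (XQ *m MQ) = map_mx iota AC *m (XQ *m MQ).
    rewrite XM; transitivity (map_mx tau (map_mx phi XQ)).
      by apply/matrixP => i j; rewrite 2!mxE phi_tau [RHS]mxE [in RHS]mxE.
    rewrite phiX map_mxM; congr (_ *m _).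
    by apply/matrixP => i j; rewrite !mxE tau_iota.
  rewrite map_mxM phiX -mulmxA => /(congr1 (mulmx (map_mx iota (invmx AC)))).
  rewrite !(mulmxA (map_mx iota (invmx AC))) -map_mxM mulVmx // map_mx1 !mul1mx.
  by move=> /(congr1 (mulmx V)); rewrite !mulmxA VX !mul1mx.
have Mc i j : exists c, MQ i j = iota (ratC C c).
  apply: quotient_constants; rewrite -phiE.
  by have := congr1 (fun Z : 'M[Q]_n => Z i j) phiM; rewrite [LHS]mxE.
pose M := \matrix_(i, j) projT1 (cid (Mc i j)).
have ME : cstQ M = MQ.
  by apply/matrixP => i j; rewrite 2!mxE; case: (cid (Mc i j)).
exists M; last by rewrite /represents -XM -ME.
rewrite unitmxE unitfE; apply/negP => /eqP M0.
have detM0 : \det MQ = 0.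
  by rewrite -ME (det_map_mx (iota \o ratC C)) M0 rmorph0.
have : tau (\det XQ * d) = 0.
  by rewrite rmorphM -det_map_mx -XM det_mulmx detM0 mulr0 mul0r.
by rewrite Xd rmorph1 => /eqP; rewrite oner_eq0.
Qed.

Section FromGalois.
Variables (tau : {rmorphism Q -> Q}) (tau_iota : forall f, tau (iota f) = iota f).
Variables (M : 'M[C]_n) (M_unit : M \in unitmx).
Hypothesis (tau_X : map_mx tau XQ = XQ *m cstQ M).

Lemma lift_to_R : exists t : {rmorphism R -> R},
  [/\ forall f, t (iK f) = iK f, map_mx t X = X *m map_mx iK (map_mx (cstK Dc \o iC) M),
    forall r, t (sR r) = sR (t r), forall r, t (dR r) = dR (t r) &
    forall r : cR, exists r' : cR, val r' = t (val r) /\ tau (psi r) = psi r'].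
Proof.
apply: (lift_automorphism (psi := psi) psi_iota tau_iota M_unit).
by rewrite XQ_psi.
Qed.

(** The endomorphism of R sending X to X M preserves calR and fixes D, so it
    extends to the tensor product over D. *)
Lemma lift_to_T : exists rho : {rmorphism T -> T},
  [/\ forall f, rho (j1 f) = j1 f, map_mx rho XT = XT *m cstT M &
      forall t, tau (piQ t) = piQ (rho t)].
Proof.
have [t [tK tX _ _ tcR]] := lift_to_R.
have [u uE] : exists u : {rmorphism cR -> cR}, forall r, val (u r) = t (val r).
  apply: (codomain_rmorph (f := t \o val)) => r.
  have [r' [e _]] := tcR r; rewrite -[X in X \in _]/(t (val r)) -e; exact: valP.
have uX i j : u (XR i j) = (XR *m map_mx (fun c => toR (cstD c)) M) i j.
  apply: val_inj; rewrite uE [RHS]val_YR -tX [RHS]mxE; congr (t _).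
  by rewrite mxE.
have [_ univ] := T_tensor.
have [|rho [rj1 rj2 _]] := univ T j1 (j2 \o u).
  move=> a; rewrite /= -j2_D; congr (j2 _); apply: val_inj.
  by rewrite uE !val_toR tK.
have rX : map_mx rho XT = XT *m cstT M.
  apply/matrixP => i j; rewrite [LHS]mxE [X in rho X]mxE rj2 /= uX !mxE rmorph_sum.
  by apply: eq_bigr => k _; rewrite rmorphM ![map_mx _ _ _ _]mxE j2_D c1D_cstD.
exists rho; split=> //.
apply: (@eq_rmorph_T _ (tau \o piQ) (piQ \o rho)).
  by move=> f; rewrite /= rj1; apply: tau_iota.
rewrite (map_mx_comp piQ tau) (map_mx_comp rho piQ) rX map_mxM pi_cst.
exact: tau_X.
Qed.

End FromGalois.

Lemma in_calR_denominator r :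
  exists2 p, p != 0 & iK (polyK Dc p) * r \in in_calR sK h iK X.
Proof.
have polyR p : iK (polyK Dc p) \in in_calR sK h iK X by exact/toR_in/polyK_in_D.
move: r (R_gen r); apply: gen_subring_ind.
- by exists 1; rewrite ?oner_neq0 // !rmorph1 mulr1 rpred1.
- move=> a b [p p0 pa] [q q0 qb]; exists (p * q); first exact: mulf_neq0.
  have key (x y : R) : x * y * (a - b) = y * (x * a) - x * (y * b) by ring.
  by rewrite rmorphM rmorphM key; apply: rpredB; apply: rpredM.
- move=> a b [p p0 pa] [q q0 qb]; exists (p * q); first exact: mulf_neq0.
  by rewrite rmorphM rmorphM mulrACA; apply: rpredM.
- move=> _ [[[f _ <-]|[i [j ->]]]|->].
  + have [p [q [p0 pf]]] := K_denominator f; exists p => //.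
    by rewrite -rmorphM pf.
  + by exists 1; rewrite ?oner_neq0 // !rmorph1 mul1r X_in_calR.
  + by exists 1; rewrite ?oner_neq0 // !rmorph1 mul1r detV_in_calR.
Qed.

(** The f with f b in calR form a stable ideal containing a denominator of b. *)
Lemma constants_in_calR b : sR b = b -> dR b = 0 -> b \in in_calR sK h iK X.
Proof.
move=> sb db.
have polyR p : iK (polyK Dc p) \in in_calR sK h iK X by exact/toR_in/polyK_in_D.
have : iK 1 * b \in in_calR sK h iK X; last by rewrite rmorph1 mul1r.
apply: (@stable_ideal_contains1 Dc dDc sK dK sK_cst sK_x dK_cst dK_x Dc_simple charD
  [set f | iK f * b \in in_calR sK h iK X]) => [f g If Ig|r f If|f If|f If|].
- by rewrite /= rmorphD mulrDl rpredD.
- by have := rpredM (polyR r) If; rewrite mulrA -[iK _ * iK f]rmorphM.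
- by rewrite /= -sR_K -{1}sb -rmorphM calR_s.
- rewrite /= -dR_K.
  have -> : dR (iK f) * b = dR (iK f * b) by rewrite derM db mulr0 addr0.
  exact: calR_d.
- by have [p p0 pb] := in_calR_denominator b; exists p.
Qed.

Section TensorSquare.
Variables (W : comNzRingType) (w1 w2 : {rmorphism R -> W}).
Hypothesis (w_K : forall f, w1 (iK f) = w2 (iK f)).
Variables (sW : automorphism W) (dW : derivation W).
Hypotheses (sW_1 : forall r, sW (w1 r) = w1 (sR r))
           (sW_2 : forall r, sW (w2 r) = w2 (sR r))
           (dW_1 : forall r, dW (w1 r) = w1 (dR r))
           (dW_2 : forall r, dW (w2 r) = w2 (dR r)).

(** The matrix Z of the Galois group, as a function of the two embeddings of R:
    exchanging them gives its inverse. *)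
Definition transition : 'M[W]_n := map_mx w1 (invmx X) *m map_mx w2 X.

Lemma mul_transition : map_mx w1 X *m transition = map_mx w2 X.
Proof. by rewrite mulmxA -map_mxM mulmxV // map_mx1 mul1mx. Qed.

Lemma transition_constant i j : transition i j \in sd_const sW dW.
Proof.
have wU (U : 'M[K]_n) : map_mx w2 (map_mx iK U) = map_mx w1 (map_mx iK U).
  by apply/matrixP => a b; rewrite !mxE w_K.
have s1 : map_mx sW (map_mx w1 X) = map_mx w1 (map_mx sR X).
  by apply/matrixP => a b; rewrite !mxE.
have s2 : map_mx sW (map_mx w2 X) = map_mx w2 (map_mx sR X).
  by apply/matrixP => a b; rewrite !mxE.
have d1 : map_mx dW (map_mx w1 X) = map_mx w1 (map_mx dR X).
  by apply/matrixP => a b; rewrite !mxE.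
have d2 : map_mx dW (map_mx w2 X) = map_mx w2 (map_mx dR X).
  by apply/matrixP => a b; rewrite !mxE.
have w1K (U : 'M[R]_n) : U \in unitmx -> forall V V' : 'M[W]_n,
    map_mx w1 U *m V = map_mx w1 U *m V' -> V = V'.
  move=> uU V V' /(congr1 (mulmx (map_mx w1 (invmx U)))).
  by rewrite !mulmxA -map_mxM mulVmx // map_mx1 !mul1mx.
have sZ : map_mx sW transition = transition.
  apply: (w1K (map_mx iK A *m X)); first by rewrite unitmx_mul map_unitmx A_unit.
  rewrite -[in LHS]sR_X -s1 -map_mxM mul_transition s2 sR_X.
  by rewrite [LHS]map_mxM wU [in RHS]map_mxM -mulmxA mul_transition.
have dZ : map_mx dW transition = 0.
  apply: (w1K X) => //; rewrite mulmx0; apply/eqP.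
  have := map_derM dW (map_mx w1 X) transition.
  rewrite mul_transition d1 d2 !dR_X [map_mx w2 _]map_mxM wU.
  rewrite [map_mx w1 (_ *m X)]map_mxM -mulmxA mul_transition.
  by move=> /eqP; rewrite -subr_eq0 opprD addrA subrr sub0r oppr_eq0.
have := congr1 (fun Z : 'M[W]_n => Z i j) sZ.
have := congr1 (fun Z : 'M[W]_n => Z i j) dZ.
rewrite ![map_mx _ _ i j]mxE [X in _ = X]mxE unfold_in /sd_const => -> ->.
by rewrite !eqxx.
Qed.

End TensorSquare.


Section GaloisGroup.
Variables (W : comNzRingType) (w1 w2 : {rmorphism R -> W}).
Hypothesis (W_tensor : is_tensor_product iK iK w1 w2).
Variables (sW : automorphism W) (dW : derivation W).
Hypotheses (sW_1 : forall r, sW (w1 r) = w1 (sR r))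
           (sW_2 : forall r, sW (w2 r) = w2 (sR r))
           (dW_1 : forall r, dW (w1 r) = w1 (dR r))
           (dW_2 : forall r, dW (w2 r) = w2 (dR r)).
Local Notation Z := (transition w1 w2).
Local Notation Wc := (sd_constants sW dW).

Lemma w_K f : w1 (iK f) = w2 (iK f).
Proof. by case: W_tensor. Qed.

Lemma Z_constant i j : Z i j \in sd_const sW dW.
Proof. exact: (transition_constant w_K sW_1 sW_2 dW_1 dW_2). Qed.

Lemma eval_transition_unit (g : {rmorphism Wc -> C}) : eval_mx Z g \in unitmx.
Proof.
pose Zc : 'M[Wc]_n := map_mx (insubd (0 : Wc)) Z.
pose Zc' : 'M[Wc]_n := map_mx (insubd (0 : Wc)) (transition w2 w1).
have ZcE : map_mx val Zc = Z.
  by apply/matrixP => i j; rewrite 2!mxE insubdK //; exact: Z_constant.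
have Zc'E : map_mx val Zc' = transition w2 w1.
  apply/matrixP => i j; rewrite 2!mxE insubdK //.
  by apply: transition_constant => // f; rewrite w_K.
have ZZ' : Zc *m Zc' = 1%:M.
  have : map_mx val (Zc *m Zc') = map_mx val (1%:M : 'M[Wc]_n).
    rewrite map_mxM ZcE Zc'E map_mx1 /transition mulmxA -[X in X *m _]mulmxA.
    by rewrite -map_mxM mulmxV // map_mx1 mulmx1 -map_mxM mulVmx // map_mx1.
  move=> e; apply/matrixP => i j; apply: val_inj.
  by have := congr1 (fun Y : 'M[W]_n => Y i j) e; rewrite [LHS]mxE [RHS]mxE.
have -> : eval_mx Z g = map_mx g Zc by apply/matrixP => i j; rewrite !mxE.
apply: (@mulmx1_unit _ _ (map_mx g Zc) (map_mx g Zc') _).1.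
by rewrite -map_mxM ZZ' map_mx1.
Qed.

(** With t the endomorphism of R sending X to X M, the morphism r1 (x) r2 |->
    r1 t(r2) sends Z to M and constants to constants of R.  The latter lie in
    calR, and their images in the quotient are sigma-constants, that is, elements
    of C; this gives the point g. *)
Lemma gal_point (tau : {rmorphism Q -> Q}) (M : 'M[C]_n) :
  (forall f, tau (iota f) = iota f) -> M \in unitmx ->
  map_mx tau XQ = XQ *m cstQ M ->
  exists2 g : {rmorphism Wc -> C},
    points (w1 \o iK \o cstK Dc \o iC) g & eval_mx Z g = M.
Proof.
move=> tau_iota M_unit tau_X.
have [t [tK tX ts td _]] := lift_to_R tau_iota M_unit tau_X.
have [_ univ] := W_tensor.
have [|u [u1 u2 _]] := univ R idfun t; first by move=> f; rewrite tK.
have usd w : u (sW w) = sR (u w) /\ u (dW w) = dR (u w).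
  move: w (tensor_generated W_tensor w); apply: gen_subring_ind.
  - by rewrite !rmorph1 !derivation1 rmorph0.
  - by move=> a b [sa da] [sb db]; rewrite !rmorphB !raddfB /= sa sb da db.
  - move=> a b [sa da] [sb db]; rewrite !rmorphM !derM rmorphD !rmorphM.
    by rewrite sa sb da db.
  - move=> _ [[r _ <-]|[r _ <-]]; first by rewrite sW_1 dW_1 !u1.
    by rewrite sW_2 dW_2 !u2 ts td.
have u_const (z : Wc) : sR (u (val z)) = u (val z) /\ dR (u (val z)) = 0.
  have /andP[/eqP sz /eqP dz] := valP z.
  have [us ud] := usd (val z); rewrite -us -ud.
  by split; [congr (u _)|rewrite -[RHS](rmorph0 u); congr (u _)].
have u_cst c : u (w1 (iK (cstK Dc (iC c)))) = val (toR (cstD c)) by rewrite u1.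
have iota_inj : injective (iota \o ratC C) by apply: fmorph_inj.
have psi_uniq (r r' : cR) : val r = val r' -> psi r = psi r' by move=> /val_inj ->.
have [|a b a' b' [r [e ce]] [r' [e' ce']]|a b a' b' [r [e ce]] [r' [e' ce']]
     |z|c [r [e ce]]|g gE] :=
  @graph_rmorph Wc C (fun z c => exists r : cR,
    val r = u (val z) /\ psi r = iota (ratC C c)).
- by exists 1; rewrite [val _]val1 [X in u X]val1 !rmorph1.
- by exists (r - r'); rewrite [LHS]valB [X in u X]valB !rmorphB e e' ce ce'.
- by exists (r * r'); rewrite [LHS]valM [X in u X]valM !rmorphM e e' ce ce'.
- have [su du] := u_const z.
  pose r : cR := SubringOf (constants_in_calR su du).
  have [c ce] : exists c, psi r = iota (ratC C c).
    apply: quotient_constants; rewrite -[psi r]/(piQ (j2 r)) quot_sT.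
    by congr (piQ _); apply: sT_2; rewrite su.
  by exists c, r.
- apply: iota_inj; rewrite [RHS]rmorph0 -[LHS]ce -(rmorph0 psi).
  by apply: psi_uniq; rewrite e [RHS]val0 [X in u X]val0 rmorph0.
have gval z c : u (val z) = val (toR (cstD c)) -> g z = c.
  move=> uz; have [r [e ce]] := gE z; apply: iota_inj.
  by rewrite -[LHS]ce -[RHS](psi_cst psi_iota); apply: psi_uniq; rewrite e.
exists g.
  by move=> c z zc; apply: gval; rewrite zc [LHS]u_cst.
apply/matrixP => i j; rewrite mxE; apply: gval.
rewrite insubdK; last exact: Z_constant.
have uZ : map_mx u Z = map_mx iK (map_mx (cstK Dc \o iC) M).
  have -> : map_mx u Z = invmx X *m map_mx t X.
    rewrite /transition map_mxM; congr (_ *m _); apply/matrixP => k l.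
      by rewrite [LHS]mxE [X in u X]mxE u1.
    by rewrite [LHS]mxE [X in u X]mxE u2 mxE.
  by rewrite tX mulKmx.
by have := congr1 (fun Y : 'M[R]_n => Y i j) uZ; rewrite [LHS]mxE => ->; rewrite !mxE.
Qed.

(** The lift of tau to T is bijective because the lift of the inverse of tau is
    its inverse. *)
Lemma gal_stab (tau : automorphism Q) (M : 'M[C]_n) :
  sigma_Gal j1 sT tau -> M \in unitmx -> represents j1 XT tau M ->
  in_stab j1 XT m M.
Proof.
move=> [_ tau_iota] M_unit tau_X.
have [tau' tauK tau'K] := aut_bij tau.
have B' := can2_zmod_morphism tauK tau'K.
have M' := can2_monoid_morphism tauK tau'K.
pose F1 := GRing.isZmodMorphism.Build Q Q tau' B'.
pose F2 := GRing.isMonoidMorphism.Build Q Q tau' M'.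
pose taui : {rmorphism Q -> Q} := HB.pack_for {rmorphism Q -> Q} tau' F1 F2.
have taui_iota f : taui (iota f) = iota f by rewrite -[X in taui X]tau_iota; exact: tauK.
have MV : invmx M \in unitmx by rewrite unitmx_inv.
have cstQM (U V : 'M[C]_n) : cstQ (U *m V) = cstQ U *m cstQ V.
  exact: (map_mxM (iota \o ratC C)).
have taui_X : map_mx taui XQ = XQ *m cstQ (invmx M).
  have : map_mx taui (map_mx tau XQ) = XQ.
    by apply/matrixP => i j; rewrite [LHS]mxE [X in taui X]mxE; exact: tauK.
  rewrite tau_X map_mxM => e.
  have <- : map_mx taui XQ *m cstQ (M *m invmx M) = map_mx taui XQ.
    by rewrite mulmxV // (map_mx1 (iota \o ratC C)) mulmx1.
  rewrite cstQM mulmxA; congr (_ *m _); rewrite -[RHS]e; congr (_ *m _).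
  apply/matrixP => i j; rewrite [LHS]mxE [RHS]mxE [X in _ = taui X]mxE.
  exact/esym/taui_iota.
have [rho [rj rX rpi]] := lift_to_T (tau := tau) tau_iota M_unit tau_X.
have [rho' [rj' rX' _]] := lift_to_T taui_iota MV taui_X.
have comp_id (r1 r2 : {rmorphism T -> T}) (U V : 'M[C]_n) : U *m V = 1%:M ->
    (forall f, r1 (j1 f) = j1 f) -> (forall f, r2 (j1 f) = j1 f) ->
    map_mx r1 XT = XT *m cstT U -> map_mx r2 XT = XT *m cstT V -> cancel r2 r1.
  move=> UV r1j r2j r1X r2X; apply: (@eq_rmorph_T _ (r1 \o r2) idfun).
    by move=> f; rewrite /= r2j r1j.
  have -> : map_mx (idfun : {rmorphism T -> T}) XT = XT.
    by apply/matrixP => i j; rewrite [LHS]mxE.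
  rewrite (map_mx_comp r2 r1) r2X map_mxM r1X -mulmxA.
  have -> : map_mx r1 (cstT V) = cstT V by apply/matrixP => i j; rewrite !mxE r1j.
  by rewrite -(map_mxM (j1 \o ratC C)) UV (map_mx1 (j1 \o ratC C)) mulmx1.
have rho_bij : bijective rho.
  exists rho'.
    by apply: (comp_id _ _ (invmx M) M) => //; rewrite mulVmx.
  by apply: (comp_id _ _ M (invmx M)) => //; rewrite mulmxV.
exists (Automorphism rho_bij); split=> // t0 /pi_eq0 t00; apply/pi_eq0.
have e : piQ t0 = 0 by exact: t00.
by have := rpi t0; rewrite e rmorph0 => /esym.
Qed.

End GaloisGroup.

End SpecializedRing.

Theorem theorem6p3
  (* C algebraically closed of characteristic 0; Dc a delta-simple domain,
     finitely generated over its field of constants C *)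
  (C : closedFieldType) (char0 : [pchar C] =i pred0)
  (Dc : idomainType) (dDc : derivation Dc) (iC : {rmorphism C -> Dc})
  (Dc_const : forall a, dDc a = 0 <-> exists c, a = iC c)
  (Dc_fingen : exists G : seq Dc,
     forall a, a \in gen_subring (range iC `|` [set` G]))
  (Dc_simple : simple_ring [set dDc : Dc -> Dc])
  (* the sigma-delta-field k0(x) *)
  (sK : automorphism (ratfun {fraction Dc}))
  (dK : derivation (ratfun {fraction Dc}))
  (sK_cst : forall a, sK (ratC _ a) = ratC _ a)
  (sK_x : sK (ratvar _) = ratvar _ + 1)
  (dK_cst : forall a : Dc, dK (cstK Dc a) = cstK Dc (dDc a))
  (dK_x : dK (ratvar _) = 0)
  (* the system *)
  (n : nat) (A B : 'M[ratfun {fraction Dc}]_n) (A_unit : A \in unitmx)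
  (AB : map_mx sK B *m A = map_mx dK A + A *m B)
  (* the sigma-delta-Picard-Vessiot ring R *)
  (R : comUnitRingType) (sR : automorphism R) (dR : derivation R)
  (sdR : forall r, sR (dR r) = dR (sR r))
  (iK : {rmorphism ratfun {fraction Dc} -> R})
  (sR_K : forall f, sR (iK f) = iK (sK f))
  (dR_K : forall f, dR (iK f) = iK (dK f))
  (R_simple : simple_ring [set (sR : R -> R); (dR : R -> R)])
  (X : 'M[R]_n) (X_unit : X \in unitmx)
  (sR_X : map_mx sR X = map_mx iK A *m X)
  (dR_X : map_mx dR X = map_mx iK B *m X)
  (R_gen : forall r, r \in gen_subring (matrix_gens (range iK) X))
  (* h, and the subring D[X, 1/det X] *)
  (h : {poly Dc}) (h_neq0 : h != 0)
  (A_loc : forall i j, A i j \in localized_at h)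
  (B_loc : forall i j, B i j \in localized_at h)
  (calR_s : forall r, (sR r \in in_calR sK h iK X) = (r \in in_calR sK h iK X))
  (calR_d : forall r, r \in in_calR sK h iK X -> dR r \in in_calR sK h iK X)
  (* W is the tensor square of R over k0(x), with its operators *)
  (W : comNzRingType) (w1 w2 : {rmorphism R -> W})
  (W_tensor : is_tensor_product iK iK w1 w2)
  (sW : automorphism W) (dW : derivation W)
  (sW_1 : forall r, sW (w1 r) = w1 (sR r))
  (sW_2 : forall r, sW (w2 r) = w2 (sR r))
  (dW_1 : forall r, dW (w1 r) = w1 (dR r))
  (dW_2 : forall r, dW (w2 r) = w2 (dR r))
  (* the specialization c1, and its extension to D *)
  (c1 : {rmorphism Dc -> C}) (c1_C : forall c, c1 (iC c) = c)
  (c1_h : map_poly c1 h != 0)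
  (c1D : {rmorphism ringD sK h -> ratfun C})
  (c1D_poly : forall (p : {poly Dc}) (a : ringD sK h),
     val a = polyK Dc p -> c1D a = tofrac (map_poly c1 p))
  (detA : \det (specialize c1D A) != 0)
  (sC : automorphism (ratfun C))
  (sC_cst : forall c, sC (ratC _ c) = ratC _ c)
  (sC_x : sC (ratvar _) = ratvar _ + 1)
  (* T is the (nonzero) tensor product of C(x) and D[X, 1/det X] over D *)
  (T : comNzRingType) (j1 : {rmorphism ratfun C -> T})
  (j2 : {rmorphism calR sK h iK X -> T})
  (T_tensor : is_tensor_product c1D (D_to_calR sK h iK X) j1 j2)
  (sT : automorphism T)
  (sT_1 : forall f, sT (j1 f) = j1 (sC f))
  (sT_2 : forall r r' : calR sK h iK X,
     val r' = sR (val r) -> sT (j2 r) = j2 r')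
  (m : idealr T) (m_max : maximal_sigma_ideal sT m) :
  let XT : 'M[T]_n := map_mx j2 (X_calR sK h iK X) in
  let Z : 'M[W]_n := map_mx w1 (invmx X) *m map_mx w2 X in
  let iW : {rmorphism C -> W} := w1 \o iK \o cstK Dc \o iC in
  let G : set {rmorphism sd_constants sW dW -> C} := points iW in
  let stab_m := [set g | G g /\ in_stab j1 XT m (eval_mx Z g)] in
  (forall tau : automorphism {ideal_quot m}, sigma_Gal j1 sT tau ->
     exists2 M : 'M[C]_n, M \in unitmx & represents j1 XT tau M) /\
  [set eval_mx Z g | g in stab_m] = sigma_Gal_mx j1 XT m sT.
Proof.
have charC k : (k%:R == 0 :> C) = (k == 0)%N by move/pcharf0P: char0 => ->.
have dDc_C c : dDc (iC c) = 0 by apply/Dc_const; exists c.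
move=> XT Z iW G stab_m; split.
  move=> tau gal.
  exact: (gal_represented charC X_unit sR_X A_loc detA sC_cst sC_x T_tensor sT_1 sT_2
    m_max gal).
apply/seteqP; split=> [_ [g [Gg stab] <-]|M [M_unit [tau gal rep]]].
  split; last exact: (stab_automorphism X_unit sR_X A_loc sC_cst T_tensor sT_1 sT_2
    m_max stab).
  exact: (eval_transition_unit A_unit X_unit sR_X dR_X W_tensor sW_1 sW_2 dW_1 dW_2).
have [_ tau_j] := gal.
have [g Gg gM] := gal_point charC dDc_C Dc_simple sK_cst sK_x dK_cst dK_x
  A_unit sR_K dR_K R_simple X_unit sR_X dR_X R_gen h_neq0 A_loc B_loc calR_s calR_d
  c1_C c1D_poly detA sC_cst sC_x T_tensor sT_1 sT_2 m_max
  W_tensor sW_1 sW_2 dW_1 dW_2 tau_j M_unit rep.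
exists g; last exact: gM.
split; first exact: Gg.
rewrite gM; exact: (gal_stab charC dDc_C Dc_simple sK_cst sK_x dK_cst dK_x
  A_unit sR_K dR_K R_simple X_unit sR_X dR_X R_gen h_neq0 A_loc B_loc
  c1_C c1D_poly detA sC_cst sC_x T_tensor gal M_unit rep).
Qed.
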